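(* For every $\alpha>0$ there exists $\varepsilon>0$ such that \[0<\liminf_{t\to\infty}\phi_\alpha(t)^{-\varepsilon}\,\mathbf{E}\left(p_t^\omega(0,0)^\varepsilon\right)\le\limsup_{t\to\infty}\phi_\alpha(t)^{-\varepsilon}\,\mathbf{E}\left(p_t^\omega(0,0)^\varepsilon\right)<\infty.\] Moreover, if $\alpha>\frac32$, then one may take $\varepsilon=1$.
   Context: One-dimensional symmetric Bouchaud trap model. Fix $\alpha>0$. Let $\tau=\{\tau_x\}_{x\in\mathbb{Z}}$ be i.i.d. random variables (the random environment, with law $\mathbf{P}$ and expectation $\mathbf{E}$; $\omega$ denotes a realisation of the environment) with $\mathbf{P}(\tau_x>u)=u^{-\alpha}$ for all $u\ge 1$. Given $\tau$, let $X=(X_t)_{t\ge0}$ be the continuous-time Markov chain on $\mathbb{Z}$ with generator $\mathcal{L}f(x)=\frac{1}{2\tau_x}\sum_{y\sim x}(f(y)-f(x))$ (sum over the two nearest neighbours of $x$). Write $P^\omega_x$ for the quenched law of $X$ started at $x$. The quenched heat kernel is $p_t^\omega(x,y)=P^\omega_x(X_t=y)/\tau_y$. Define $\phi_\alpha(t)=t^{-1/(1+\alpha)}$ if $\alpha\in(0,1)$, $\phi_\alpha(t)=t^{-1/2}(\log t)^{-1/2}$ if $\alpha=1$, and $\phi_\alpha(t)=t^{-1/2}$ if $\alpha>1$. *)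

(* Defs.v *)
From HB Require Import structures.
From mathcomp Require Import all_boot all_order all_algebra.
From mathcomp Require Import all_classical all_reals all_analysis.
Set Implicit Arguments. Unset Strict Implicit. Unset Printing Implicit Defensive.
Import Order.TTheory GRing.Theory Num.Theory.
Import numFieldNormedType.Exports.
Local Open Scope classical_set_scope.
Local Open Scope ring_scope.

Section BTM.
Variable R : realType.

(* Generator of the symmetric Bouchaud trap model with environment tau :
   (L f)(x) = 1/(2 tau_x) * sum_{y ~ x} (f y - f x). *)
Definition btm_gen (tau : int -> R) (f : int -> R) : int -> R :=
  fun x => (2 * tau x)^-1 * ((f (x + 1) - f x) + (f (x - 1) - f x)).

Definition btm_gen_pow (tau : int -> R) (n : nat) (y : int) : int -> R :=
  iter n (btm_gen tau) (fun x => (x == y)%:R).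

(* Quenched transition probability P^omega_x(X_t = y) = (exp(tL) 1_{y})(x)
   (the generator is bounded since tau >= 1). *)
Definition btm_trans (tau : int -> R) (t : R) (x y : int) : R :=
  limn (fun N : nat => \sum_(0 <= n < N) (t ^+ n / (n`!)%:R * btm_gen_pow tau n y x)).

Definition btm_heat_kernel (tau : int -> R) (t : R) (x y : int) : R :=
  btm_trans tau t x y / tau y.

Definition phi_alpha (alpha t : R) : R :=
  if alpha < 1 then powR t (- (1 + alpha)^-1)
  else if alpha == 1 then powR t (- 2^-1) * powR (ln t) (- 2^-1)
  else powR t (- 2^-1).

Definition pareto_iid_env d (Omega : measurableType d) (P : probability Omega R)
    (alpha : R) (tau : int -> Omega -> R) : Prop :=
  [/\ (forall x, measurable_fun setT (tau x)),
      (forall x u, 1 <= u -> P [set w | u < tau x w] = (powR u (- alpha))%:E) &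
      (forall s : seq int, uniq s -> forall B : int -> set R,
          (forall x, measurable (B x)) ->
          P (\bigcap_(x in [set` s]) (tau x @^-1` B x)) =
          (\prod_(x <- s) P (tau x @^-1` B x))%E)].

Definition normalized_moment d (Omega : measurableType d) (P : probability Omega R)
    (alpha : R) (tau : int -> Omega -> R) (eps t : R) : \bar R :=
  ((powR (phi_alpha alpha t) (- eps))%:E *
   \int[P]_w (powR (btm_heat_kernel (fun x => tau x w) t 0 0) eps)%:E)%E.

Definition two_sided_bound d (Omega : measurableType d) (P : probability Omega R)
    (alpha : R) (tau : int -> Omega -> R) (eps : R) : Prop :=
  let f := normalized_moment P alpha tau eps in
  [/\ (0 < limf_einf f (pinfty_nbhs R))%E,
      (limf_einf f (pinfty_nbhs R) <= limf_esup f (pinfty_nbhs R))%E &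
      (limf_esup f (pinfty_nbhs R) < +oo)%E].

End BTM.

(* Main.v *)
Require Import Defs.
From HB Require Import structures.
From mathcomp Require Import all_boot all_order all_algebra.
From mathcomp Require Import all_classical all_reals all_analysis.
From mathcomp Require Import measurable_realfun.
From mathcomp Require Import ring lra zify.
Import Order.TTheory GRing.Theory Num.Theory.
Import numFieldNormedType.Exports.
Local Open Scope ring_scope.
Set Implicit Arguments. Unset Strict Implicit. Unset Printing Implicit Defensive.

(** Everything holds with exponent 1, because the quenched kernel obeys deterministic two-sided
    bounds in terms of the volumes V(r), the sum of tau over [0, r), and W(r) = V(r) +
    V'(r), where V' is the sum over (-r, 0]. Let q(n) be the return kernel at 0 of the lazy
    chain I + L/2, so that p_t(0,0) is the mean of q(n) when n is Poisson with parameter 2t,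
    and let G(N) be the sum of q(n) over n < N.

    Applying the chain to functions with an explicit Laplacian gives G(N) <= N/V(r) + 4r for
    every r (solve L h = delta_0/tau_0 - 1_[0,r)/V(r)) and G(N) >= N/(W(r) + N/(2r)) (the
    same function, and a tent function to bound the probability of leaving (-r, r)). The
    lazy chain is self-adjoint and nonnegative, so q is nonincreasing, whence (G(N) -
    G(n))/N <= q(n) <= G(n+1)/(n+1). The resulting bounds on q(n) are affine in n and in
    1/(n+1) respectively, so their Poisson means are explicit.

    It remains to see that E(1/V(r)) = O(1/v(r)) and that E(1/(W(r)+c)) is at least of order
    1/(v(r)+c), where v(r) is r^(1/alpha), r log r or r. If r v(r) is of order t, then
    1/v(r) is of order phi_alpha(t); for the lower bound on p_t(0,0) one uses the scale k r
    in G(N), with N of order k r v(k r) and k a large constant. *)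

(** * The lazy chain *)

Section LazyStep.
Variables (R : realType) (tau : int -> R).
Implicit Types (f g h : int -> R) (x y : int) (n N : nat).

(* The laziness makes the spectrum nonnegative, hence the return kernel nonincreasing. *)
Definition lazy_step f : int -> R := fun x => f x + 2^-1 * btm_gen tau f x.

Definition lazy_iter n f : int -> R := iter n lazy_step f.
Arguments lazy_iter : simpl never.

Lemma lazy_iterS n f : lazy_iter n.+1 f = lazy_step (lazy_iter n f).
Proof. by []. Qed.

Lemma lazy_iterSr n f : lazy_iter n.+1 f = lazy_iter n (lazy_step f).
Proof. exact: iterSr. Qed.

Lemma lazy_step_lin f g a b :
  lazy_step (fun x => a * f x + b * g x) =
  (fun x => a * lazy_step f x + b * lazy_step g x).
Proof. by apply/funext => x; rewrite /lazy_step /btm_gen; ring. Qed.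

Lemma lazy_iter_lin n f g a b :
  lazy_iter n (fun x => a * f x + b * g x) =
  (fun x => a * lazy_iter n f x + b * lazy_iter n g x).
Proof.
elim: n f g => [//|n IHn] f g.
by rewrite !lazy_iterS IHn lazy_step_lin.
Qed.

Lemma lazy_iterZ n f a : lazy_iter n (fun x => a * f x) = (fun x => a * lazy_iter n f x).
Proof.
have -> : (fun x => a * f x) = (fun x => a * f x + 0 * f x).
  by apply/funext => x; rewrite mul0r addr0.
by rewrite lazy_iter_lin; apply/funext => x; rewrite mul0r addr0.
Qed.

Lemma lazy_iterD n f g x :
  lazy_iter n f x + lazy_iter n g x = lazy_iter n (fun y => f y + g y) x.
Proof.
have -> : (fun y => f y + g y) = (fun y => 1 * f y + 1 * g y).
  by apply/funext => y; rewrite !mul1r.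
by rewrite lazy_iter_lin !mul1r.
Qed.

Lemma lazy_iter_cst n c : lazy_iter n (fun=> c) = (fun=> c).
Proof.
elim: n => [//|n IHn]; rewrite lazy_iterS IHn.
by apply/funext => x; rewrite /lazy_step /btm_gen; ring.
Qed.

(** Discrete Dynkin formula: the lazy step minus the identity is half the generator, so the
    increments of its powers telescope. *)
Lemma lazy_iter_telescope N h x :
  lazy_iter N h x - h x = \sum_(n < N) lazy_iter n (fun y => 2^-1 * btm_gen tau h y) x.
Proof.
elim: N => [|N IHN]; first by rewrite big_ord0 subrr.
rewrite big_ord_recr /= -IHN lazy_iterSr.
have -> : lazy_step h = (fun y => 1 * h y + 1 * (2^-1 * btm_gen tau h y)).
  by apply/funext => y; rewrite !mul1r.
by rewrite lazy_iter_lin; ring.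
Qed.

Hypothesis tau_ge1 : forall x, 1 <= tau x.

Lemma tau_gt0 x : 0 < tau x. Proof. exact: lt_le_trans ltr01 (tau_ge1 x). Qed.

(** Form with explicit transition weights; [tau_ge1] makes the holding weight at least 1/2, whence
    positivity preservation. *)
Lemma lazy_stepE f x : lazy_step f x =
  (1 - (2 * tau x)^-1) * f x + (4 * tau x)^-1 * (f (x + 1) + f (x - 1)).
Proof.
have := lt0r_neq0 (tau_gt0 x); rewrite /lazy_step /btm_gen => t0.
by field.
Qed.

Lemma lazy_step_ge0 f : (forall x, 0 <= f x) -> forall x, 0 <= lazy_step f x.
Proof.
move=> f0 x; rewrite lazy_stepE addr_ge0//; last first.
  by rewrite mulr_ge0 ?addr_ge0// invr_ge0 mulr_ge0// ltW// tau_gt0.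
rewrite mulr_ge0// subr_ge0 invf_le1 ?mulr_gt0 ?tau_gt0//.
by have := tau_ge1 x; lra.
Qed.

Lemma lazy_iter_ge0 n f : (forall x, 0 <= f x) -> forall x, 0 <= lazy_iter n f x.
Proof. by move=> f0; elim: n => [//|n IHn]; exact: lazy_step_ge0. Qed.

Lemma ler_lazy_iter n f g x : (forall y, f y <= g y) -> lazy_iter n f x <= lazy_iter n g x.
Proof.
move=> fg; rewrite -subr_ge0.
have -> : lazy_iter n g x - lazy_iter n f x =
    lazy_iter n (fun y => 1 * g y + (-1) * f y) x by rewrite lazy_iter_lin; ring.
by apply: lazy_iter_ge0 => y; have := fg y; lra.
Qed.

(** The q(n) of the overview, a density with respect to the reversible measure tau; [green] is
    G(N). *)
Definition lazy_green_at n : R := lazy_iter n (fun x => (x == 0)%:R) 0 / tau 0.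

Definition green N : R := \sum_(n < N) lazy_green_at n.

End LazyStep.

(** * The Green function at the origin *)

Section Green.
Variables (R : realType) (tau : int -> R).
Implicit Types (x y : int) (n N r : nat).

Definition half_volume r : R := \sum_(0 <= i < r) tau i%:Z.

Definition half_ball r : int -> R :=
  fun x => if x is Posz k then (k < r)%N%:R else 0.

(* Solution of L h = delta_0 / tau_0 - 1_[0, r) / half_volume r that vanishes on the
   negative half-line; on the positive one its slope decreases from 2 to 0. *)
Definition green_test_slope r k : R := 2 * (\sum_(k.+1 <= i < r) tau i%:Z) / half_volume r.

Definition green_test r : int -> R :=
  fun x => if x is Posz k then \sum_(0 <= j < k) green_test_slope r j else 0.

Hypothesis tau_ge1 : forall x, 1 <= tau x.
Let tau_gt0 := tau_gt0 tau_ge1.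

Lemma half_volume_ge r : r%:R <= half_volume r.
Proof.
rewrite /half_volume -[in leLHS](subn0 r) -sumr_const_nat.
by rewrite ler_sum_nat.
Qed.

Lemma half_volume_gt0 r : (0 < r)%N -> 0 < half_volume r.
Proof. by move=> r0; apply: lt_le_trans (half_volume_ge r); rewrite ltr0n. Qed.

Lemma green_test_le0 r x : x <= 0 -> green_test r x = 0.
Proof. by case: x => [[|k]|k] //= _; rewrite big_geq. Qed.

Lemma green_test_slope_bound r k : (0 < r)%N ->
  0 <= green_test_slope r k <= if (k < r)%N then 2 else 0.
Proof.
move=> r0; have V0 := half_volume_gt0 r0.
have s0 : 0 <= \sum_(k.+1 <= i < r) tau i%:Z by apply: sumr_ge0 => i _; apply/ltW.
rewrite /green_test_slope divr_ge0 ?mulr_ge0 ?(ltW V0)//=.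
case: ltnP => kr; last first.
  by rewrite (big_geq (leqW kr)) mulr0 mul0r.
rewrite ler_pdivrMr// ler_pM2l// /half_volume [leRHS](big_cat_nat (n := k.+1))//=.
by rewrite lerDr; apply: sumr_ge0 => i _; apply/ltW.
Qed.

(** The slopes lie in [0, 2] and vanish from r on, so the function climbs by at most 2 along each of
    r edges. *)
Lemma green_test_bound r x : (0 < r)%N -> 0 <= green_test r x <= 2 * r%:R.
Proof.
move=> r0; case: x => [k|k] /=; last by rewrite lexx mulr_ge0.
apply/andP; split.
  by apply: sumr_ge0 => i _; have /andP[] := green_test_slope_bound i r0.
apply: (@le_trans _ _ (\sum_(0 <= j < k) if (j < r)%N then 2 else 0)).
  by apply: ler_sum => i _; have /andP[] := green_test_slope_bound i r0.
elim: k => [|k IHk]; first by rewrite big_geq// mulr_ge0.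
have [kr|rk] := ltnP k r; last first.
  by rewrite big_nat_recr//= ltnNge rk addr0.
apply: (@le_trans _ _ (\sum_(0 <= j < k.+1) 2)); first by apply: ler_sum => i _; case: ifP.
by rewrite sumr_const_nat subn0 -[leLHS]mulr_natr ler_pM2l// ler_nat.
Qed.

(** Across a site k of (0, r) the slope drops by 2 tau_k / V, which the rate 1/(2 tau_k) turns into
    the constant 1/V; at 0 it jumps from 0 to 2 (V - tau_0) / V. *)
Lemma btm_gen_green_test r x : (0 < r)%N ->
  btm_gen tau (green_test r) x = (x == 0)%:R / tau 0 - half_ball r x / half_volume r.
Proof.
move=> r0; have /lt0r_neq0 V0 := half_volume_gt0 r0.
have /lt0r_neq0 tx := tau_gt0 x.
case: x tx => [[|k]|k] tx; rewrite /btm_gen.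
- rewrite (green_test_le0 _ (x := 0))// (green_test_le0 _ (x := 0 - 1))//.
  rewrite add0r /= big_nat1 /green_test_slope r0.
  have -> : \sum_(1 <= i < r) tau i = half_volume r - tau 0.
    by rewrite /half_volume (big_ltn r0) /=; ring.
  change (Posz 0) with (0 : int) in *; rewrite -[true%:R]/(1 : R).
  by field; rewrite V0.
- have -> : Posz k.+1 + 1 = Posz k.+2 by lia.
  have -> : Posz k.+1 - 1 = Posz k by lia.
  have -> : (Posz k.+1 == 0) = false by [].
  rewrite /= !big_nat_recr//= /green_test_slope.
  case: ltnP => kr.
    rewrite (big_ltn kr) -[true%:R]/(1 : R) mul0r.
    by field; rewrite V0.
  rewrite (big_geq kr) (big_geq (leqW kr)) !mulr0 !mul0r; ring.
- rewrite !green_test_le0; [|lia..].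
  by rewrite /= !mul0r; ring.
Qed.

(** Dynkin's formula for [green_test] at 0, where it vanishes: occupation time of the half ball over
    V, plus the terminal value. Bounding both terms gives [green_le]; dropping the second gives
    [green_ge_half]. *)
Lemma half_volume_green r N : (0 < r)%N ->
  green tau N = (\sum_(n < N) lazy_iter tau n (half_ball r) 0) / half_volume r +
                2 * lazy_iter tau N (green_test r) 0.
Proof.
move=> r0.
have := lazy_iter_telescope tau N (green_test r) 0.
rewrite (green_test_le0 _ (x := 0))// subr0 => ->.
rewrite mulr_sumr mulr_suml -big_split/=; apply: eq_bigr => n _.
rewrite /lazy_green_at.
have -> : (fun y : int => 2^-1 * btm_gen tau (green_test r) y) =
   (fun y => (2 * tau 0)^-1 * (y == 0)%:R + (- (2 * half_volume r)^-1) * half_ball r y).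
  apply/funext => y; rewrite btm_gen_green_test//.
  by field; rewrite !lt0r_neq0// half_volume_gt0.
rewrite lazy_iter_lin.
by field; rewrite !lt0r_neq0// half_volume_gt0.
Qed.

Lemma green_le r N : (0 < r)%N -> green tau N <= N%:R / half_volume r + 4 * r%:R.
Proof.
move=> r0; rewrite (half_volume_green _ r0) lerD//.
  rewrite ler_wpM2r ?invr_ge0 ?(ltW (half_volume_gt0 r0))//.
  have -> : (N%:R : R) = \sum_(n < N) 1 by rewrite sumr_const card_ord.
  apply: ler_sum => n _; rewrite -[leRHS](congr1 (@^~ 0) (lazy_iter_cst tau n 1)).
  apply: ler_lazy_iter => // -[k|k] //=.
  by rewrite lern1 leq_b1.
rewrite -[leRHS](_ : 2 * (2 * r%:R) = _); last by ring.
rewrite ler_pM2l//; apply: le_trans (_ : lazy_iter tau N (fun=> 2 * r%:R) 0 <= _).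
  by apply: ler_lazy_iter => // y; have /andP[] := green_test_bound y r0.
by rewrite lazy_iter_cst.
Qed.

Lemma green_ge_half r N : (0 < r)%N ->
  \sum_(n < N) lazy_iter tau n (half_ball r) 0 <= green tau N * half_volume r.
Proof.
move=> r0; have V0 := half_volume_gt0 r0.
rewrite (half_volume_green _ r0) mulrDl divfK ?lt0r_neq0// lerDl.
rewrite !mulr_ge0// ?(ltW V0)//; apply: lazy_iter_ge0 => // y.
by have /andP[] := green_test_bound y r0.
Qed.

Definition tent r : int -> R := fun x => Num.max 0 (1 - `|x|%:~R / r%:R).

(** The only concave kink of the tent is its apex, where each neighbour is lower by at most 1/r;
    elsewhere the tent is locally convex. *)
Lemma btm_gen_tent r x : (0 < r)%N -> - ((x == 0)%:R / (r%:R * tau 0)) <= btm_gen tau (tent r) x.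
Proof.
move=> r0; have r0' : 0 < r%:R :> R by rewrite ltr0n.
pose a := (r%:R : R)^-1; have a0 : 0 < a by rewrite invr_gt0.
rewrite /btm_gen /tent -/a.
have [->|x0] := eqVneq x 0.
  rewrite normr0 add0r sub0r normrN normr1 mul0r subr0.
  have -> : - (true%:R / (r%:R * tau 0)) = (2 * tau 0)^-1 * (- (2 * a)).
    by rewrite -[true%:R]/(1 : R) /a; field; rewrite !lt0r_neq0.
  rewrite ler_pM2l ?invr_gt0 ?mulr_gt0//.
  have : 1 - 1%:~R * a <= Num.max 0 (1 - 1%:~R * a) by rewrite le_max lexx orbT.
  rewrite (max_r (x := 0) (y := 1)) ?ler01//; lra.
rewrite mul0r oppr0 mulr_ge0 ?invr_ge0 ?mulr_ge0 ?(ltW (tau_gt0 _))//.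
(* Here e = 1 or -1 is the sign of x; the claim becomes midpoint convexity of u -> max(0, 1 -
   u/r). *)
have : exists2 e : int, `|x + 1| = `|x| + e & `|x - 1| = `|x| - e.
  by case: (ltP 0 x) => ?; [exists 1 | exists (-1)]; lia.
move=> [e -> ->]; rewrite !intrD rmorphN/=.
set u := `|x|%:~R; set v := e%:~R.
have := le_max (1 - (u + v) * a) 0 (1 - (u + v) * a).
have := le_max 0 0 (1 - (u + v) * a).
have := le_max (1 - (u - v) * a) 0 (1 - (u - v) * a).
have := le_max 0 0 (1 - (u - v) * a).
rewrite !lexx orbT orTb => h1 h2 h3 h4.
by rewrite [Num.max 0 (1 - u * a)]maxEle; case: ifP => _; nra.
Qed.

End Green.

Lemma btm_gen_reflect (R : realType) (tau f : int -> R) x :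
  btm_gen (fun y => tau (- y)) (fun y => f (- y)) x = btm_gen tau f (- x).
Proof.
by rewrite /btm_gen !opprD opprK [X in f (- x - X) - _ + _]/=; ring.
Qed.

Lemma lazy_iter_reflect (R : realType) (tau f : int -> R) n :
  lazy_iter (fun y => tau (- y)) n (fun y => f (- y)) = (fun x => lazy_iter tau n f (- x)).
Proof.
elim: n => [//|n IHn]; rewrite !lazy_iterS IHn; apply/funext => x.
by rewrite /lazy_step btm_gen_reflect.
Qed.

(** Return to 0 does not see orientation, so every bound through
    [0, r) has a twin through (-r, 0]. *)
Lemma lazy_green_at_reflect (R : realType) (tau : int -> R) n :
  lazy_green_at (fun y => tau (- y)) n = lazy_green_at tau n.
Proof.
rewrite /lazy_green_at oppr0; congr (_ / _).
have -> : (fun x : int => (x == 0)%:R : R) = (fun x => (- x == 0)%:R).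
  by apply/funext => x; rewrite oppr_eq0.
rewrite (lazy_iter_reflect _ (fun x => (x == 0)%:R)) oppr0.
by congr lazy_iter; apply/funext => x; rewrite oppr_eq0.
Qed.

(** The W(r) of the overview: site 0 counts twice, because the bounds for the two half balls are
    added. *)
Definition volume (R : realType) (tau : int -> R) (r : nat) : R :=
  half_volume tau r + half_volume (fun x => tau (- x)) r.

(** * Lower bound on the Green function *)

Section GreenLower.
Variables (R : realType) (tau : int -> R).
Hypothesis tau_ge1 : forall x, 1 <= tau x.

(** The tent starts at 1 and loses at most q(k)/(2r) at step k. As it lies below the indicator of
    (-r, r), this bounds the exit probability. *)
Lemma lazy_iter_tent n r : (0 < r)%N ->
  1 - green tau n / (2 * r%:R) <= lazy_iter tau n (tent R r) 0.
Proof.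
move=> r0; have r0' : (r%:R : R) != 0 by rewrite pnatr_eq0 -lt0n.
have := lazy_iter_telescope tau n (tent R r) 0.
rewrite {2}/tent normr0 mul0r subr0 (max_r ler01) => /eqP; rewrite subr_eq => /eqP ->.
rewrite addrC lerD2r /green mulr_suml -sumrN.
apply: ler_sum => k _; rewrite /lazy_green_at.
have t0 := lt0r_neq0 (tau_gt0 tau_ge1 0).
have -> : - (lazy_iter tau k (fun x => (x == 0)%:R) 0 / tau 0 / (2 * r%:R)) =
   lazy_iter tau k (fun x => - (2 * r%:R * tau 0)^-1 * (x == 0)%:R) 0.
  by rewrite lazy_iterZ; field; rewrite r0' t0.
apply: ler_lazy_iter => // y.
have -> : - (2 * r%:R * tau 0)^-1 * (y == 0)%:R = 2^-1 * (- ((y == 0)%:R / (r%:R * tau 0))).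
  by field; rewrite r0' t0.
by rewrite ler_pM2l ?invr_gt0// btm_gen_tent.
Qed.

Lemma green_le_mono m n : (m <= n)%N -> green tau m <= green tau n.
Proof.
move=> mn; rewrite /green -!(big_mkord xpredT (lazy_green_at tau)).
rewrite [leRHS](big_cat_nat (n := m))//= lerDl; apply: sumr_ge0 => i _.
rewrite divr_ge0// ?(ltW (tau_gt0 tau_ge1 0))//.
by apply: lazy_iter_ge0 => // y; case: (y == 0).
Qed.

(** Adding the two half-ball bounds and the exit estimate gives N (1 - G/(2r)) <= G W, which is
    solved for G. *)
Lemma green_ge r N : (0 < r)%N ->
  N%:R / (volume tau r + N%:R / (2 * r%:R)) <= green tau N.
Proof.
move=> r0; have r0' : 0 < r%:R :> R by rewrite ltr0n.
have V1 := half_volume_gt0 tau_ge1 r0.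
have V2 : 0 < half_volume (fun x => tau (- x)) r by apply: half_volume_gt0.
rewrite ler_pdivrMr; last by rewrite ltr_pwDl ?addr_gt0// divr_ge0// mulr_ge0// ltW.
have gR : green (fun x => tau (- x)) N = green tau N.
  by apply: eq_bigr => n _; rewrite lazy_green_at_reflect.
have h1 := green_ge_half tau_ge1 N r0.
have h2 : _ <= _ := @green_ge_half _ (fun x => tau (- x)) (fun x => tau_ge1 (- x)) r N r0.
rewrite gR in h2.
suff h3 : N%:R * (1 - green tau N / (2 * r%:R)) <=
    \sum_(n < N) lazy_iter tau n (half_ball R r) 0 +
    \sum_(n < N) lazy_iter (fun x => tau (- x)) n (half_ball R r) 0.
  have -> : green tau N * (volume tau r + N%:R / (2 * r%:R)) =
    green tau N * half_volume tau r + green tau N * half_volume (fun x => tau (- x)) r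
    + N%:R * (green tau N / (2 * r%:R)) by rewrite /volume; field; rewrite lt0r_neq0.
  lra.
rewrite -big_split/=.
rewrite [leLHS](_ : _ = \sum_(n < N) (1 - green tau N / (2 * r%:R))); last first.
  by rewrite sumr_const card_ord mulr_natl.
apply: ler_sum => n _.
apply: le_trans (_ : 1 - green tau n / (2 * r%:R) <= _).
  rewrite lerD2l lerN2 ler_pM2r ?invr_gt0 ?mulr_gt0//.
  by apply: green_le_mono; apply: ltnW.
apply: le_trans (lazy_iter_tent n r0) _.
(* Written as a double reflection, the half ball of the reflected chain becomes the left half ball
   of the original one. *)
have -> : half_ball R r = (fun y => (fun x => half_ball R r (- x)) (- y)).
  by apply/funext => y; rewrite opprK.
rewrite (lazy_iter_reflect tau (fun x => half_ball R r (- x))) oppr0.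
have -> : (fun y => half_ball R r (- - y)) = half_ball R r.
  by apply/funext => y; rewrite opprK.
rewrite lazy_iterD.
(* The tent is at most 1 and vanishes outside (-r, r), which the two half balls cover. *)
apply: ler_lazy_iter => // y; rewrite /tent.
have t1 : 1 - `|y|%:~R / r%:R <= 1 :> R by rewrite lerBlDr lerDl divr_ge0// ?ler0z// ltW.
have hb0 z : 0 <= half_ball R r z by case: z.
have [yr|yr] := leP r%:Z `|y|.
  rewrite max_l ?addr_ge0// subr_le0 ler_pdivlMr// mul1r.
  by rewrite -[r%:R]/(r%:~R) ler_int.
rewrite ge_max addr_ge0//=; apply: le_trans t1 _.
have hb1 k : (k < r)%N -> half_ball R r (Posz k) = 1 by rewrite /half_ball => ->.
case: y yr => [k|k] yr; first by rewrite [X in _ <= X + _]hb1 ?lerDl//; lia.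
have -> : - Negz k = Posz k.+1 by lia.
by rewrite [X in _ <= _ + X]hb1 ?lerDr//; lia.
Qed.

End GreenLower.

(** * Monotonicity of the return kernel *)

Section ReturnMonotone.
Variables (R : realType) (tau : int -> R).
Hypothesis tau_ge1 : forall x, 1 <= tau x.
Implicit Types (f g : int -> R) (x : int) (n m M : nat).

Definition supported M f := forall x, M%:Z <= `|x| -> f x = 0.

(** Inner product of l2(tau) cut to the window [-M, M); working with finitely supported functions
    keeps all sums finite. *)
Definition speed_form M f g : R :=
  \sum_(0 <= i < M.*2) tau (i%:Z - M%:Z) * f (i%:Z - M%:Z) * g (i%:Z - M%:Z).

Lemma supported_lazy_step M f : supported M f -> supported M.+1 (lazy_step tau f).
Proof.
move=> fM x xM; rewrite lazy_stepE// !fM; [|lia..].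
by rewrite addr0 !mulr0 addr0.
Qed.

(** Summation by parts: F x sits on the edge from x to x + 1, and the two assumptions concern the
    edges that leave the window. *)
Lemma window_telescope M (F : int -> R) : F (M%:Z - 1) = 0 -> F (- M%:Z - 1) = 0 ->
  \sum_(0 <= i < M.*2) (F (i%:Z - M%:Z) - F (i%:Z - M%:Z - 1)) = 0.
Proof.
move=> F1 F2.
rewrite (eq_bigr (fun i : nat => F (i.+1%:Z - M%:Z - 1) - F (i%:Z - M%:Z - 1))); last first.
  by move=> i _; congr (F _ - _); lia.
rewrite (telescope_sumr (fun i : nat => F (i%:Z - M%:Z - 1)))//.
have -> : M.*2%:Z - M%:Z - 1 = M%:Z - 1 by lia.
by rewrite F1 add0r sub0r F2 oppr0.
Qed.

Lemma speed_form_sym M f g : supported M f -> supported M g ->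
  speed_form M (lazy_step tau f) g = speed_form M f (lazy_step tau g).
Proof.
move=> fM gM; apply/eqP; rewrite -subr_eq0 /speed_form -sumrB.
(* Detailed balance: the weight tau cancels the jump rate, and the integrands differ by the
   increment of this discrete Wronskian. *)
pose F x := 4^-1 * (f (x + 1) * g x - f x * g (x + 1)).
rewrite (eq_bigr (fun i : nat => F (i%:Z - M%:Z) - F (i%:Z - M%:Z - 1))).
  apply/eqP; apply: window_telescope.
  - by rewrite /F subrK (fM M%:Z) ?(gM M%:Z) ?mulr0 ?mul0r ?subrr ?mulr0//; lia.
  - by rewrite /F subrK (fM (- M%:Z)) ?(gM (- M%:Z)) ?mulr0 ?mul0r ?subrr ?mulr0//; lia.
move=> i _; set x := i%:Z - M%:Z; rewrite !lazy_stepE// /F subrK.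
by field; rewrite lt0r_neq0// (tau_gt0 tau_ge1).
Qed.

(** After summation by parts the difference is the Dirichlet form, a sum of squares of f x - f (x +
    1). *)
Lemma speed_form_lazy_step_le M f : supported M f ->
  speed_form M (lazy_step tau f) f <= speed_form M f f.
Proof.
move=> fM; rewrite -subr_ge0 /speed_form -sumrB.
pose G x := 4^-1 * ((f x - f (x + 1)) * f (x + 1)).
rewrite (eq_bigr (fun i : nat => (G (i%:Z - M%:Z) - G (i%:Z - M%:Z - 1)) +
   4^-1 * (f (i%:Z - M%:Z) - f (i%:Z - M%:Z + 1)) ^+ 2)).
  rewrite big_split/= window_telescope ?add0r.
  - by apply: sumr_ge0 => i _; rewrite mulr_ge0// sqr_ge0.
  - by rewrite /G subrK (fM M%:Z) ?mulr0//; lia.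
  - by rewrite /G subrK (fM (- M%:Z)) ?mulr0//; lia.
move=> i _; set x := i%:Z - M%:Z; rewrite lazy_stepE// /G subrK.
by field; rewrite lt0r_neq0// (tau_gt0 tau_ge1).
Qed.

(** Laziness enters here: up to a telescoping increment the integrand is a quarter of the square of
    f x + f (x + 1), plus (tau x - 1) f(x)^2. *)
Lemma speed_form_lazy_step_ge0 M f : supported M f ->
  0 <= speed_form M (lazy_step tau f) f.
Proof.
move=> fM; pose G x := 4^-1 * (- f x * f (x + 1) - f (x + 1) ^+ 2).
apply: (@le_trans _ _ (\sum_(0 <= i < M.*2) ((G (i%:Z - M%:Z) - G (i%:Z - M%:Z - 1)) +
   4^-1 * (f (i%:Z - M%:Z) + f (i%:Z - M%:Z + 1)) ^+ 2))).
  rewrite big_split/= window_telescope ?add0r.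
  - by apply: sumr_ge0 => i _; rewrite mulr_ge0// sqr_ge0.
  - by rewrite /G subrK (fM M%:Z) ?mulr0 ?expr0n ?subr0 ?mulr0//; lia.
  - by rewrite /G subrK (fM (- M%:Z)) ?mulr0 ?expr0n ?subr0 ?mulr0//; lia.
apply: ler_sum => i _; set x := i%:Z - M%:Z; rewrite lazy_stepE// /G subrK.
rewrite -subr_ge0.
rewrite [leRHS](_ : _ = (tau x - 1) * f x ^+ 2).
  by rewrite mulr_ge0 ?sqr_ge0// subr_ge0.
by field; rewrite lt0r_neq0// (tau_gt0 tau_ge1).
Qed.

Let delta0 : int -> R := fun x => (x == 0)%:R.

Lemma supported_return M n : (n < M)%N -> supported M (lazy_iter tau n delta0).
Proof.
elim: n M => [|n IHn] [//|M] nM; last first.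
  by rewrite lazy_iterS; apply: supported_lazy_step; apply: IHn.
by move=> x xM; rewrite /lazy_iter /delta0/=; case: eqP => // x0; lia.
Qed.

(** Self-adjointness moves all the powers to one side, and pairing with the delta function evaluates
    at 0; the window is wide enough for every iterate involved. *)
Lemma speed_form_return M m n : (m + n < M)%N ->
  speed_form M (lazy_iter tau m delta0) (lazy_iter tau n delta0) =
  tau 0 * lazy_iter tau (m + n) delta0 0.
Proof.
elim: m n => [|m IHm] n mnM; last first.
  rewrite lazy_iterS speed_form_sym; [|apply: supported_return; lia..].
  by rewrite -lazy_iterS IHm addnS -addSn.
(* Index M of the window is the site 0. *)
rewrite /speed_form (bigD1_seq M) ?iota_uniq ?mem_index_iota; [|lia|by []].
rewrite [X in _ + X = _]big1 ?addr0.
  by rewrite subrr /lazy_iter/= /delta0 eqxx mulr1.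
move=> i iM; rewrite /lazy_iter/= /delta0.
have -> : (i%:Z - M%:Z == 0) = false by apply/eqP; move/eqP: iM; lia.
by rewrite mulr0 mul0r.
Qed.

(** Let f be the iterate of order n/2 of the delta function and Q the lazy step. Even n is the
    contraction (Qf, f) <= (f, f); odd n is (Qf, Qf) <= (Qf, f), where nonnegativity of Q is
    used. *)
Lemma lazy_green_at_nincr n : lazy_green_at tau n.+1 <= lazy_green_at tau n.
Proof.
have t0 := tau_gt0 tau_ge1 0.
rewrite /lazy_green_at ler_pM2r ?invr_gt0// -/delta0 -(ler_pM2l t0).
pose k := n./2; pose M := n.+3; pose f := lazy_iter tau k delta0.
have fM : supported M f by apply: supported_return; rewrite /M /k; lia.
have fM' : supported M (lazy_step tau f).
  by rewrite -lazy_iterS; apply: supported_return; rewrite /M /k; lia.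
have [nE|nE] := boolP (odd n); last first.
  have -> : n = (k + k)%N by rewrite /k; lia.
  rewrite -addSn -!(@speed_form_return M) ?lazy_iterS -/f.
  - exact: speed_form_lazy_step_le.
  - by rewrite /M /k; lia.
  - by rewrite /M /k; lia.
have -> : n = (k.+1 + k)%N by rewrite /k; lia.
have -> : (k.+1 + k).+1 = (k.+1 + k.+1)%N by lia.
rewrite -!(@speed_form_return M) ?lazy_iterS -/f; [|rewrite /M /k; lia..].
(* Q (I - Q) = Q (I - Q) Q + (I - Q) Q (I - Q). *)
pose g x := 1 * f x + (-1) * lazy_step tau f x.
have gM : supported M g by move=> x xM; rewrite /g fM// fM'//; ring.
have h1 := speed_form_lazy_step_le fM'.
have h2 := speed_form_lazy_step_ge0 gM.
have expand : speed_form M (lazy_step tau g) g =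
   speed_form M (lazy_step tau f) f - speed_form M (lazy_step tau f) (lazy_step tau f) *+ 2
   + speed_form M (lazy_step tau (lazy_step tau f)) (lazy_step tau f).
  have -> : speed_form M (lazy_step tau f) (lazy_step tau f) *+ 2 =
     speed_form M (lazy_step tau f) (lazy_step tau f) +
     speed_form M (lazy_step tau (lazy_step tau f)) f.
    by rewrite (speed_form_sym fM' fM) mulr2n.
  rewrite /speed_form -big_split -sumrB -big_split/=; apply: eq_bigr => i _.
  by rewrite lazy_step_lin /g; ring.
move: h2; rewrite expand mulr2n; lra.
Qed.

Lemma lazy_green_at_le m n : (m <= n)%N -> lazy_green_at tau n <= lazy_green_at tau m.
Proof.
move=> /subnK <-; elim: (n - m)%N => [//|k IHk].
by rewrite addSn; apply: le_trans IHk; apply: lazy_green_at_nincr.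
Qed.

Lemma lazy_green_at_ge0 n : 0 <= lazy_green_at tau n.
Proof.
rewrite divr_ge0// ?(ltW (tau_gt0 tau_ge1 0))//.
by apply: lazy_iter_ge0 => // y; case: (y == 0).
Qed.

Lemma lazy_green_at_le1 n : lazy_green_at tau n <= 1.
Proof.
apply: le_trans (lazy_green_at_le (leq0n n)) _.
rewrite /lazy_green_at /lazy_iter/= mul1r invf_le1//.
exact: tau_gt0.
Qed.

Lemma lazy_green_at_upper r n : (0 < r)%N ->
  lazy_green_at tau n <= (half_volume tau r)^-1 + 4 * r%:R / n.+1%:R.
Proof.
move=> r0; have n0 : (0 : R) < n.+1%:R by rewrite ltr0n.
rewrite -(ler_pM2r n0) mulrDl divfK ?lt0r_neq0// [X in X + _]mulrC.
apply: le_trans (green_le tau_ge1 n.+1 r0).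
rewrite mulr_natr /green -[n.+1 in leLHS]card_ord -sumr_const.
by apply: ler_sum => i _; apply: lazy_green_at_le; rewrite -ltnS.
Qed.

Lemma lazy_green_at_lower r R0 N n : (0 < r)%N -> (0 < R0)%N -> (0 < N)%N ->
  (volume tau R0 + N%:R / (2 * R0%:R))^-1 - (n%:R / half_volume tau r + 4 * r%:R) / N%:R
  <= lazy_green_at tau n.
Proof.
move=> r0 R00 N0; have N0' : (0 : R) < N%:R by rewrite ltr0n.
rewrite -(ler_pM2r N0') mulrBl divfK ?lt0r_neq0//.
have h1 := green_ge tau_ge1 N R00; rewrite mulrC in h1.
have h2 := green_le tau_ge1 n r0.
suff : green tau N - green tau n <= lazy_green_at tau n * N%:R by lra.
(* For N < n the left side is nonpositive; otherwise it has N - n terms, each at most q(n). *)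
have [nN|Nn] := leqP n N; last first.
  apply: le_trans (_ : 0 <= _); last by rewrite mulr_ge0// ?lazy_green_at_ge0// ltW.
  by rewrite subr_le0 green_le_mono// ltnW.
rewrite /green -!(big_mkord xpredT (lazy_green_at tau)).
rewrite (big_cat_nat (n := n) (p := N))//= [_ + \sum_(n <= _ < _) _]addrC addrK.
apply: (@le_trans _ _ (\sum_(n <= i < N) lazy_green_at tau n)).
  by rewrite !big_nat; apply: ler_sum => i /andP[ni _]; apply: lazy_green_at_le.
rewrite sumr_const_nat -[leLHS]mulr_natr ler_wpM2l ?lazy_green_at_ge0//.
by rewrite ler_nat leq_subr.
Qed.

End ReturnMonotone.

(** * From the lazy chain to the heat kernel *)

Local Open Scope classical_set_scope.

(** * Cauchy products of series dominated by an exponential series *)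

Section CauchyProduct.
Variables (R : realType).
Implicit Types (u v : nat -> R) (x : R).

Lemma triangle_sum u v N :
  \sum_(0 <= n < N) \sum_(k < n.+1) u k * v (n - k)%N =
  \sum_(i < N) \sum_(0 <= j < N - i) u i * v j.
Proof.
elim: N => [|N IHN]; first by rewrite big_geq// big_ord0.
rewrite big_nat_recr//= IHN [RHS]big_ord_recr/= subSnn big_nat1.
rewrite [X in _ + X = _]big_ord_recr/= subnn addrA -big_split/=; congr (_ + _).
by apply: eq_bigr => i _; rewrite subSn ?(ltnW (ltn_ord i))// big_nat_recr.
Qed.

(** Isolates the corner of the square that the Cauchy product misses, to be compared termwise with
    the corner of the exponential series. *)
Lemma square_sub_triangle u v N :
  series u N * series v N - \sum_(0 <= n < N) \sum_(k < n.+1) u k * v (n - k)%N =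
  \sum_(i < N) \sum_(N - i <= j < N) u i * v j.
Proof.
rewrite triangle_sum /series/= [X in X * _]big_mkord mulr_suml -sumrB.
apply: eq_bigr => i _; rewrite mulr_sumr.
by rewrite (big_cat_nat (n := (N - i)%N))//= ?leq_subr// [X in X - _]addrC addrK.
Qed.

Lemma exp_coeff_triangle x n :
  \sum_(k < n.+1) exp_coeff x k * exp_coeff x (n - k)%N = exp_coeff (x + x) n.
Proof.
rewrite /exp_coeff/= exprDn mulr_suml; apply: eq_bigr => -[k kn] _ /=.
rewrite -mulr_natr -(bin_fact (n := n) (m := k))// natrM natrM.
field; rewrite !pnatr_eq0 -!lt0n !fact_gt0 /=.
by rewrite bin_gt0 -ltnS kn.
Qed.

(* The discrepancy is dominated by the one of e^x e^x = e^(2x). *)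
Lemma cauchy_product_cvg u v x (U V : R) : 0 <= x ->
  (forall n, `|u n| <= exp_coeff x n) -> (forall n, `|v n| <= exp_coeff x n) ->
  series u @ \oo --> U -> series v @ \oo --> V ->
  series (fun n => \sum_(k < n.+1) u k * v (n - k)%N) @ \oo --> U * V.
Proof.
move=> x0 ux vx uU vV.
pose e := exp_coeff x.
have eE : series e @ \oo --> expR x by exact: is_cvg_series_exp_coeff.
have e2E : series (exp_coeff (x + x)) @ \oo --> expR (x + x) by exact: is_cvg_series_exp_coeff.
have bound N : `|series u N * series v N - series (fun n => \sum_(k < n.+1) u k * v (n - k)%N) N|
    <= series e N * series e N - series (exp_coeff (x + x)) N.
  have -> : series (exp_coeff (x + x)) N =
      \sum_(0 <= n < N) \sum_(k < n.+1) e k * e (n - k)%N.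
    by rewrite /series/=; apply: eq_bigr => n _; rewrite exp_coeff_triangle.
  rewrite !square_sub_triangle; apply: le_trans (ler_norm_sum _ _ _) _.
  apply: ler_sum => i _; apply: le_trans (ler_norm_sum _ _ _) _.
  by apply: ler_sum => j _; rewrite normrM ler_pM.
have lim0 : (fun N => series e N * series e N - series (exp_coeff (x + x)) N) @ \oo --> (0 : R).
  rewrite -[0](subrr (expR (x + x))) [in X in X - _]expRD.
  by apply: cvgB => //; apply: cvgM.
have d0 : (fun N => series u N * series v N -
   series (fun n => \sum_(k < n.+1) u k * v (n - k)%N) N) @ \oo --> (0 : R).
  apply: norm_cvg0; apply: squeeze_cvgr (cvg_cst 0) lim0.
  by apply: nearW => N; rewrite normr_ge0 bound.
have -> : series (fun n => \sum_(k < n.+1) u k * v (n - k)%N) =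
   (fun N => series u N * series v N - (series u N * series v N -
   series (fun n => \sum_(k < n.+1) u k * v (n - k)%N) N)).
  by apply/funext => N; rewrite opprB addrC subrK.
rewrite -[U * V]subr0.
by apply: cvgB => //; apply: cvgM.
Qed.

End CauchyProduct.

(** * The heat kernel as a Poisson average of the return kernel *)

Section HeatKernel.
Variables (R : realType) (tau : int -> R).

(** Binomial theorem for the generator written as 2Q - 2I, with Q the lazy step; the induction is
    Pascal's rule. *)
Lemma btm_gen_iter n f x : iter n (btm_gen tau) f x =
  \sum_(k < n.+1) 'C(n, k)%:R * (2 ^+ k * (- 2) ^+ (n - k)) * lazy_iter tau k f x.
Proof.
have lin m f1 f2 a b y : iter m (btm_gen tau) (fun z => a * f1 z + b * f2 z) y =
    a * iter m (btm_gen tau) f1 y + b * iter m (btm_gen tau) f2 y.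
  elim: m y => [//|m IHm] y; rewrite !iterS /btm_gen !IHm.
  by ring.
elim: n f => [|n IHn] f.
  by rewrite big_ord_recl big_ord0 bin0 /lazy_iter/= !mul1r addr0.
have -> : iter n.+1 (btm_gen tau) f x =
    iter n (btm_gen tau) (fun z => 2 * lazy_step tau f z + (- 2) * f z) x.
  rewrite iterSr; congr (iter n (btm_gen tau) _ x); apply/funext => z.
  by rewrite /lazy_step; field.
rewrite lin !IHn [RHS]big_ord_recl/= bin0 subn0 mul1r.
under [in RHS]eq_bigr => i _ do
  rewrite /bump /= add1n binS natrD mulrDl mulrDl subSS.
rewrite big_split/= addrA addrC; congr (_ + _).
  rewrite mulr_sumr; apply: eq_bigr => i _.
  by rewrite -lazy_iterSr lazy_iterS add0n exprS; ring.
rewrite mulr_sumr [LHS]big_ord_recl/= [in RHS]big_ord_recr/= (bin_small (ltnSn n)) !mul0r addr0.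
rewrite bin0 subn0 mul1r; congr (_ + _); first by rewrite exprS /lazy_iter/=; ring.
apply: eq_bigr => i _; rewrite /bump/= !add1n !add0n.
have -> : (n - i = (n - i.+1).+1)%N by have := ltn_ord i; lia.
by rewrite [in RHS](exprS (- 2)); ring.
Qed.

Hypothesis tau_ge1 : forall x, 1 <= tau x.
Variable t : R.
Hypothesis t0 : 0 < t.
Let lam := 2 * t.

Let weighted_return n := exp_coeff lam n * lazy_green_at tau n.

(** Degree n in t of the factorization exp(tL) = exp(2tQ) exp(-2t), read at 0. *)
Lemma heat_term n : t ^+ n / n`!%:R * btm_gen_pow tau n 0 0 / tau 0 =
  \sum_(k < n.+1) weighted_return k * exp_coeff (- lam) (n - k)%N.
Proof.
rewrite /btm_gen_pow btm_gen_iter mulr_sumr mulr_suml; apply: eq_bigr => -[k kn] _ /=.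
rewrite /weighted_return /lazy_green_at /exp_coeff/= -(bin_fact (n := n) (m := k))// 2!natrM.
have -> : t ^+ n = t ^+ k * t ^+ (n - k) by rewrite -exprD subnKC.
have -> : - lam = (- 2) * t by rewrite /lam; ring.
rewrite /lam !exprMn.
field; rewrite (lt0r_neq0 (tau_gt0 tau_ge1 0)) !pnatr_eq0 -!lt0n !fact_gt0 /=.
by rewrite bin_gt0 -ltnS kn.
Qed.

Lemma lam_gt0 : 0 < lam. Proof. by rewrite mulr_gt0. Qed.

Lemma exp_coeff_lam_ge0 n : 0 <= exp_coeff lam n.
Proof. by rewrite /exp_coeff/= divr_ge0// exprn_ge0// ltW// lam_gt0. Qed.

Lemma series_exp_coeff_le (n : nat) : series (exp_coeff lam) n <= expR lam.
Proof.
apply: nondecreasing_cvgn_le; last exact: is_cvg_series_exp_coeff.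
by apply: nondecreasing_series => k _ _; exact: exp_coeff_lam_ge0.
Qed.

Lemma weighted_return_series_nd : nondecreasing_seq (series weighted_return).
Proof.
apply: nondecreasing_series => k _ _.
by rewrite mulr_ge0 ?exp_coeff_lam_ge0 ?lazy_green_at_ge0.
Qed.

Lemma weighted_return_le n : weighted_return n <= exp_coeff lam n.
Proof. by rewrite ler_piMr ?exp_coeff_lam_ge0 ?lazy_green_at_le1. Qed.

Lemma weighted_return_series_cvg : cvgn (series weighted_return).
Proof.
apply: nondecreasing_is_cvgn; first exact: weighted_return_series_nd.
exists (expR lam) => _ [n _ <-]; apply: le_trans (series_exp_coeff_le n).
by apply: ler_sum => k _; apply: weighted_return_le.
Qed.

Lemma heat_series_cvg :
  (fun N : nat => \sum_(0 <= n < N) (t ^+ n / n`!%:R * btm_gen_pow tau n 0 0)) @ \oo -->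
  tau 0 * (limn (series weighted_return) * expR (- lam)).
Proof.
have t00 := lt0r_neq0 (tau_gt0 tau_ge1 0).
have -> : (fun N : nat => \sum_(0 <= n < N) (t ^+ n / n`!%:R * btm_gen_pow tau n 0 0)) =
  (fun N => tau 0 *
     series (fun n => \sum_(k < n.+1) weighted_return k * exp_coeff (- lam) (n - k)%N) N).
  apply/funext => N; rewrite /series/= mulr_sumr; apply: eq_bigr => n _.
  by rewrite -heat_term [RHS]mulrC divfK.
apply: cvgMr; apply: (@cauchy_product_cvg _ _ _ lam); first exact/ltW/lam_gt0.
- by move=> n; rewrite ger0_norm ?weighted_return_le// mulr_ge0 ?exp_coeff_lam_ge0 ?lazy_green_at_ge0.
- move=> n; rewrite /exp_coeff/= normrM normrX normrN normfV normr_nat.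
  by rewrite gtr0_norm ?lam_gt0.
- exact: weighted_return_series_cvg.
- exact: is_cvg_series_exp_coeff.
Qed.

Lemma heat_kernelE : btm_heat_kernel tau t 0 0 = limn (series weighted_return) * expR (- lam).
Proof.
rewrite /btm_heat_kernel /btm_trans (cvg_lim _ heat_series_cvg)//.
by rewrite mulrC mulKf// lt0r_neq0// (tau_gt0 tau_ge1).
Qed.

Lemma heat_kernel_ge0 : 0 <= btm_heat_kernel tau t 0 0.
Proof.
rewrite heat_kernelE mulr_ge0 ?expR_ge0//.
apply: le_trans (nondecreasing_cvgn_le weighted_return_series_nd weighted_return_series_cvg 0).
by rewrite /series/= big_geq.
Qed.

(** Poisson mean of [lazy_green_at_upper]: the mean of 1/(n+1) is at most 1/[lam], and 4r/[lam] is
    2r/t. *)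
Lemma heat_kernel_upper r : (0 < r)%N ->
  btm_heat_kernel tau t 0 0 <= (half_volume tau r)^-1 + 2 * r%:R / t.
Proof.
move=> r0; have V0 := half_volume_gt0 tau_ge1 r0.
rewrite heat_kernelE expRN ler_pdivrMr ?expR_gt0//.
apply: limr_le; first exact: weighted_return_series_cvg.
apply: nearW => N.
(* The coefficient of order i over i + 1 is the coefficient of order i + 1 over [lam], hence the
   shift to [N.+1]. *)
apply: (@le_trans _ _ ((half_volume tau r)^-1 * series (exp_coeff lam) N +
   (2 * r%:R / t) * series (exp_coeff lam) N.+1)).
  rewrite [X in _ + _ * X]/series/= big_nat_recl//= mulrDr addrCA.
  apply: (@le_trans _ _ ((half_volume tau r)^-1 * series (exp_coeff lam) N +
     2 * r%:R / t * \sum_(0 <= i < N) exp_coeff lam i.+1)); last first.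
    by rewrite lerDr mulr_ge0 ?exp_coeff_lam_ge0// divr_ge0// ?(ltW t0)// mulr_ge0.
  rewrite /series/= !mulr_sumr -big_split/=; apply: ler_sum => i _.
  apply: le_trans (ler_wpM2l (exp_coeff_lam_ge0 i) (lazy_green_at_upper tau_ge1 i r0)) _.
  rewrite mulrDr [X in X + _ <= _]mulrC lerD2l /exp_coeff/= factS natrM exprS /lam.
  rewrite le_eqVlt; apply/orP; left; apply/eqP; field.
  by rewrite -[1 + _](natrD _ 1%N) !pnatr_eq0 -!lt0n fact_gt0 addn_gt0 lt0r_neq0.
rewrite [leRHS]mulrDl; apply: lerD; rewrite ler_wpM2l ?series_exp_coeff_le//.
  by rewrite invr_ge0 ltW.
by rewrite divr_ge0// ?(ltW t0)// mulr_ge0.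
Qed.

(** The lower bound on q(n) has the form a - b n, and the Poisson mean of n is [lam]. *)
Lemma heat_kernel_lower r R0 N : (0 < r)%N -> (0 < R0)%N -> (0 < N)%N ->
  (volume tau R0 + N%:R / (2 * R0%:R))^-1 - (2 * t / half_volume tau r + 4 * r%:R) / N%:R
  <= btm_heat_kernel tau t 0 0.
Proof.
move=> r0 R00 N0; have V0 := half_volume_gt0 tau_ge1 r0.
have N0' : (0 : R) < N%:R by rewrite ltr0n.
rewrite heat_kernelE expRN ler_pdivlMr ?expR_gt0//.
set A := (volume tau R0 + _)^-1.
pose a := A - 4 * r%:R / N%:R.
pose b := (half_volume tau r * N%:R)^-1.
have b0 : 0 <= b by rewrite invr_ge0 mulr_ge0// ltW.
have -> : (A - (2 * t / half_volume tau r + 4 * r%:R) / N%:R) * expR lam =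
   a * expR lam - b * lam * expR lam.
  by rewrite /a /b /lam; field; rewrite !lt0r_neq0.
(* The sign of [a] is unknown, so its partial sums stay exact; only the b-term is replaced by its
   limit. *)
have step n : a * series (exp_coeff lam) n.+1 - b * lam * expR lam <= series weighted_return n.+1.
  apply: (@le_trans _ _ (a * series (exp_coeff lam) n.+1 - b * lam * series (exp_coeff lam) n)).
    rewrite lerD2l lerN2; apply: ler_wpM2l; last exact: series_exp_coeff_le.
    by apply: mulr_ge0 b0 _; exact: ltW lam_gt0.
  have -> : b * lam * series (exp_coeff lam) n =
     \sum_(0 <= i < n.+1) b * (i%:R * exp_coeff lam i).
    rewrite big_nat_recl//= mul0r mulr0 add0r /series/= mulr_sumr; apply: eq_bigr => i _.
    rewrite /exp_coeff/= factS natrM exprS; field.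
    by rewrite -[1 + _](natrD _ 1%N) !pnatr_eq0 -!lt0n fact_gt0.
  rewrite /series/= mulr_sumr -sumrB; apply: ler_sum => i _.
  have := ler_wpM2l (exp_coeff_lam_ge0 i) (lazy_green_at_lower tau_ge1 i r0 R00 N0).
  apply: le_trans; rewrite le_eqVlt; apply/orP; left; apply/eqP; rewrite -/A /a /b /weighted_return; field.
  by rewrite !lt0r_neq0.
have c1 : (fun n => a * series (exp_coeff lam) n.+1 - b * lam * expR lam) @ \oo -->
    a * expR lam - b * lam * expR lam.
  apply: cvgB; last exact: cvg_cst.
  apply: cvgMr; rewrite (cvg_shiftS (series (exp_coeff lam))).
  exact: is_cvg_series_exp_coeff.
have c2 : (fun n => series weighted_return n.+1) @ \oo --> limn (series weighted_return).
  by rewrite (cvg_shiftS (series weighted_return)); exact: weighted_return_series_cvg.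
by apply: (ler_cvg_to c1 c2); apply: nearW => n; exact: step.
Qed.

End HeatKernel.

(** * Means of nonnegative functions *)

Section MeasurableLim.
Context d (T : measurableType d) (R : realType).

Lemma cvgn_limn_esup (s : nat -> R) : cvgn s <->
  limn_esup (EFin \o s) = limn_einf (EFin \o s) /\ limn_esup (EFin \o s) \is a fin_num.
Proof.
split=> [/cvg_ex[/= l sl]|[es fin]].
  have /cvg_limn_einf_sup[-> ->] : EFin \o s @ \oo --> l%:E.
    by apply: cvg_EFin => //; exact: nearW.
  by [].
apply/cvg_ex; exists (fine (limn_esup (EFin \o s))).
suff : EFin \o s @ \oo --> limn_esup (EFin \o s).
  by rewrite -{1}(fineK fin) => /fine_cvgP[].
apply: (squeeze_cvge _ (f := einfs (EFin \o s)) (h := esups (EFin \o s))).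
- apply: nearW => n; apply/andP; split.
    by apply: ereal_inf_lbound; exists n => /=.
  by apply: ereal_sup_ubound; exists n => /=.
- by rewrite es limn_einf_lim; exact: is_cvg_einfs.
- by rewrite limn_esup_lim; exact: is_cvg_esups.
Qed.

(** The criterion above makes the set of convergence measurable, and off it [limn] is the default
    [point]. This matters because the environment is at least 1 only almost surely. *)
Lemma measurable_fun_limn (s : nat -> T -> R) : (forall n, measurable_fun setT (s n)) ->
  measurable_fun setT (fun w => limn (s ^~ w)).
Proof.
move=> ms; pose e (w : T) := limn_esup (EFin \o (s ^~ w)).
pose i (w : T) := limn_einf (EFin \o (s ^~ w)).
have me : measurable_fun setT e.
  by apply: measurable_fun_limn_esup => n; apply/measurable_EFinP.
have mi : measurable_fun setT i.
  have -> : i = (-%E \o (fun w => limn_esup (EFin \o (fun n => - s n w)%R)))%E.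
    by apply/funext => w; rewrite /i /limn_einf.
  apply: (measurableT_comp (f := -%E)); first exact: oppe_measurable.
  by apply: measurable_fun_limn_esup => n; apply/measurable_EFinP; exact: measurable_funN.
have -> : (fun w => limn (s ^~ w)) =
    (fun w => if (e w == i w) && (e w \is a fin_num) then fine (e w) else point).
  apply/funext => w; have [cs|ncs] := pselect (cvgn (s ^~ w)).
    have [ei fi] := (cvgn_limn_esup _).1 cs.
    rewrite /e /i -ei eqxx fi/=; apply/cvg_lim => //.
    move/cvg_ex : cs => [/= l sl].
    have /cvg_limn_einf_sup[_ ->] : EFin \o (s ^~ w) @ \oo --> l%:E.
      by apply: cvg_EFin => //; exact: nearW.
    by [].
  rewrite (dvgP ncs); case: ifP => // /andP[/eqP ei fi].
  by exfalso; apply: ncs; apply/cvgn_limn_esup.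
apply: measurable_fun_ifT; last 2 first.
- exact: measurableT_comp me.
- exact: measurable_cst.
apply: measurable_and.
  apply: (measurable_fun_bool true).
  rewrite (_ : _ @^-1` _ = [set w | e w = i w]); first exact: measurable_eqe.
  by apply/seteqP; split => w /= /eqP.
apply: (measurable_fun_bool true).
rewrite (_ : _ @^-1` _ = [set w | e w \is a fin_num]); first exact: emeasurable_fin_num.
by apply/seteqP; split => w.
Qed.

End MeasurableLim.

Section HasMean.
Context d (Omega : measurableType d) (R : realType) (P : probability Omega R).
Implicit Types (f g : Omega -> R) (m c : R).

(** Bundles what the integration lemmas ask for, so that expectations are handled as real
    numbers. *)
Definition has_mean f m :=
  [/\ measurable_fun setT f, forall w, 0 <= f w & (\int[P]_w (f w)%:E = m%:E)%E].

Lemma has_mean_cst c : 0 <= c -> has_mean (fun=> c) c.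
Proof.
move=> c0; split => //.
by rewrite integral_cst// [X in (_ * X)%E]probability_setT mule1.
Qed.

Lemma has_meanD f g m c : has_mean f m -> has_mean g c -> has_mean (fun w => f w + g w) (m + c).
Proof.
move=> [mf f0 fm] [mg g0 gc]; split.
- exact: measurable_funD.
- by move=> w; rewrite addr_ge0.
- rewrite EFinD -fm -gc -ge0_integralD//.
  + by move=> w _; rewrite lee_fin.
  + by apply/measurable_EFinP.
  + by move=> w _; rewrite lee_fin.
  + by apply/measurable_EFinP.
Qed.

Lemma has_meanZ f m c : 0 <= c -> has_mean f m -> has_mean (fun w => c * f w) (c * m).
Proof.
move=> c0 [mf f0 fm]; split.
- by apply: measurable_funM => //; exact: measurable_cst.
- by move=> w; rewrite mulr_ge0.
- under eq_integral do rewrite EFinM.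
  rewrite ge0_integralZl ?lee_fin// ?fm//.
  + by apply/measurable_EFinP.
  + by move=> w _; rewrite lee_fin.
Qed.

Lemma has_mean_sum (I : Type) (s : seq I) (f : I -> Omega -> R) (m : I -> R) :
  (forall i, has_mean (f i) (m i)) ->
  has_mean (fun w => \sum_(i <- s) f i w) (\sum_(i <- s) m i).
Proof.
move=> fm; elim: s => [|i s IHs].
  rewrite big_nil (_ : (fun w => _) = fun=> 0); first exact: has_mean_cst.
  by apply/funext => w; rewrite big_nil.
rewrite big_cons (_ : (fun w => _) = fun w => f i w + \sum_(i <- s) f i w).
  exact: has_meanD.
by apply/funext => w; rewrite big_cons.
Qed.

Lemma has_mean_le f g m c : has_mean f m -> has_mean g c ->
  {ae P, forall w, f w <= g w} -> m <= c.
Proof.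
move=> [mf f0 fm] [mg g0 gc] fg; rewrite -lee_fin -fm -gc.
apply: ae_ge0_le_integral => //.
- by move=> w _; rewrite lee_fin.
- by apply/measurable_EFinP.
- by move=> w _; rewrite lee_fin.
- by apply/measurable_EFinP.
- by apply: filterS fg => w; rewrite lee_fin.
Qed.

Lemma has_mean_ge0 f m : has_mean f m -> 0 <= m.
Proof.
move=> fm; apply: (has_mean_le (has_mean_cst (lexx 0)) fm).
by case: fm => _ f0 _; apply: aeW.
Qed.

Lemma has_mean_bounded f c : measurable_fun setT f -> (forall w, 0 <= f w) -> 0 <= c ->
  {ae P, forall w, f w <= c} -> exists m, has_mean f m.
Proof.
move=> mf f0 c0 fc.
have fin : (0 <= \int[P]_w (f w)%:E <= c%:E)%E.
  apply/andP; split; first by apply: integral_ge0 => w _; rewrite lee_fin.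
  have [_ _ <-] := has_mean_cst c0; apply: ae_ge0_le_integral => //.
  - by move=> w _; rewrite lee_fin.
  - by apply/measurable_EFinP.
  - by apply: filterS fc => w; rewrite lee_fin.
exists (fine (\int[P]_w (f w)%:E)); split => //.
rewrite fineK// fin_numE; case/andP: fin => h0 hc.
apply/andP; split; first by rewrite gt_eqF// (lt_le_trans _ h0)// ltNy0.
by rewrite lt_eqF// (le_lt_trans hc)// ltry.
Qed.

Lemma has_mean_indic (A : set Omega) m : measurable A -> P A = m%:E -> has_mean \1_A m.
Proof.
move=> mA PA; split => //.
by rewrite integral_indic// setIT.
Qed.

End HasMean.

(** * The Pareto environment *)

Section Dyadic.
Variable R : realFieldType.
Implicit Types (x : R) (K : nat).

Lemma sum_expr2 K : \sum_(0 <= k < K) 2 ^+ k = 2 ^+ K - 1 :> R.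
Proof.
elim: K => [|K IHK]; first by rewrite big_geq// expr0 subrr.
by rewrite big_nat_recr//= IHK exprS; ring.
Qed.

(** Exceeding level K means exceeding all lower ones. If K is the last level exceeded, the sum is
    within [x - 1, 2x], the source of the next two bounds. *)
Lemma sum_expr2_gt x K : 2 ^+ K < x ->
  \sum_(0 <= k < K.+1) (2 : R) ^+ k * (2 ^+ k < x)%R%:R = 2 ^+ K.+1 - 1.
Proof.
move=> Kx; rewrite -sum_expr2; apply: eq_big_nat => k; rewrite ltnS => /andP[_ kK].
have -> : 2 ^+ k < x by apply: le_lt_trans Kx; rewrite ler_weXn2l// ler1n.
by rewrite mulr1.
Qed.

Lemma dyadic_upper x K : x <= 2 ^+ K ->
  x <= 1 + \sum_(0 <= k < K) (2 : R) ^+ k * (2 ^+ k < x)%R%:R.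
Proof.
elim: K => [|K IHK] xK; first by rewrite big_geq// addr0.
have [xK'|xK'] := leP x (2 ^+ K).
  apply: le_trans (IHK xK') _; rewrite lerD2l big_nat_recr//= lerDl.
  by rewrite mulr_ge0// exprn_ge0.
by rewrite sum_expr2_gt//; lra.
Qed.

Lemma dyadic_lower x K : 0 <= x ->
  \sum_(0 <= k < K) (2 : R) ^+ k * (2 ^+ k < x)%R%:R <= 2 * x.
Proof.
move=> x0; elim: K => [|K IHK]; first by rewrite big_geq// mulr_ge0.
have [xK'|xK'] := leP x (2 ^+ K).
  by rewrite big_nat_recr//= ltNge xK' mulr0 addr0.
by rewrite sum_expr2_gt// exprS; lra.
Qed.

(** A geometric sum is dominated by its top term. The right side is linear in the indicators, so its
    mean needs only one-site tails. *)
Lemma dyadic_sqr x K :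
  (\sum_(0 <= k < K) (2 : R) ^+ k * (2 ^+ k < x)%R%:R) ^+ 2 <=
  \sum_(0 <= k < K) (4 : R) ^+ k.+1 * (2 ^+ k < x)%R%:R.
Proof.
elim: K => [|K IHK]; first by rewrite !big_geq// expr0n.
have [xK'|xK'] := leP x (2 ^+ K).
  by rewrite !big_nat_recr//= ltNge xK' !mulr0 !addr0.
rewrite sum_expr2_gt// big_nat_recr//= xK' mulr1.
apply: (@le_trans _ _ (4 ^+ K.+1)); last first.
  by rewrite lerDr; apply: sumr_ge0 => k _; rewrite mulr_ge0// exprn_ge0.
have -> : 4 = 2 ^+ 2 :> R by rewrite expr2; ring.
rewrite -exprM mulnC exprM ler_sqr ?nnegrE ?exprn_ge0//; first lra.
by rewrite subr_ge0 exprn_ege1// ler1n.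
Qed.

(** The highest level reached already carries enough weight to cover x. *)
Lemma dyadic_layers x K : x <= 2 ^+ K ->
  x <= 1 + \sum_(0 <= k < K) (2 : R) ^+ k.+1 * (2 ^+ k <= x)%R%:R.
Proof.
elim: K => [|K IHK] xK; first by rewrite big_geq// addr0.
have s0 : 0 <= \sum_(0 <= k < K) (2 : R) ^+ k.+1 * (2 ^+ k <= x)%R%:R :> R.
  by apply: sumr_ge0 => k _; rewrite mulr_ge0// exprn_ge0.
rewrite big_nat_recr//=; have [xK'|xK'] := lerP (2 ^+ K) x.
  by rewrite mulr1; lra.
by rewrite mulr0 addr0; apply: IHK; exact: ltW.
Qed.

End Dyadic.

(** * Exceedance probabilities of the traps *)

Section Environment.
Context (R : realType) d (Omega : measurableType d) (P : probability Omega R).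
Variables (alpha : R) (tau : int -> Omega -> R).
Hypothesis henv : pareto_iid_env P alpha tau.

Let mtau x : measurable_fun setT (tau x). Proof. by case: henv. Qed.

Let env w : int -> R := fun x => tau x w.

(** The tail formula at u = 1 gives tau > 1 almost surely at each site; a countable intersection
    over the two constructors of [int] makes this simultaneous. *)
Lemma env_ge1_ae : {ae P, forall w, forall x, 1 <= env w x}.
Proof.
have h x : {ae P, forall w, 1 <= tau x w}.
  exists (~` [set w | 1 < tau x w]); split.
  - apply: measurableC; rewrite -[X in measurable X]setTI.
    by rewrite -(preimage_itvoy (tau x) 1); apply: mtau.
  - rewrite probability_setC; last first.
      rewrite -[X in measurable X]setTI.
      by rewrite -(preimage_itvoy (tau x) 1); apply: mtau.
    have [_ -> // _] := henv.
    by rewrite powR1 subee.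
  - by move=> w /= /negP; rewrite -ltNge => w1; apply/negP; rewrite -leNgt ltW.
have hp : {ae P, forall w, forall n : nat, 1 <= tau (Posz n) w}.
  by apply: ae_foralln => n; exact: h.
have hn : {ae P, forall w, forall n : nat, 1 <= tau (Negz n) w}.
  by apply: ae_foralln => n; exact: h.
by apply: filterS2 hp hn => w wp wn [].
Qed.

Definition exceed (x : int) (u : R) (w : Omega) : R := (u < tau x w)%R%:R.

Let exceed_set x u : set Omega := tau x @^-1` `]u, +oo[.

Lemma exceedE x u : exceed x u = \1_(exceed_set x u).
Proof.
apply/funext => w; rewrite indicE /exceed; congr (nat_of_bool _)%:R.
by apply/idP/idP; rewrite inE /exceed_set/= in_itv/= andbT.
Qed.

Lemma measurable_exceed x u : measurable (exceed_set x u).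
Proof. by rewrite -[X in measurable X]setTI; apply: mtau. Qed.

Lemma prob_exceed x u : 1 <= u -> P (exceed_set x u) = (powR u (- alpha))%:E.
Proof.
move=> u1; have [_ h _] := henv; rewrite -(h x)//; congr (P _).
by apply/seteqP; split => w; rewrite /exceed_set/= in_itv/= andbT.
Qed.

Lemma has_mean_exceed x u : 1 <= u -> has_mean P (exceed x u) (powR u (- alpha)).
Proof.
by move=> u1; rewrite exceedE; apply: has_mean_indic; rewrite ?prob_exceed//; exact: measurable_exceed.
Qed.

Lemma has_mean_exceed2 x y u v : x != y -> 1 <= u -> 1 <= v ->
  has_mean P (fun w => exceed x u w * exceed y v w) (powR u (- alpha) * powR v (- alpha)).
Proof.
move=> xy u1 v1.
have -> : (fun w => exceed x u w * exceed y v w) = \1_(exceed_set x u `&` exceed_set y v).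
  by apply/funext => w; rewrite indicI !exceedE.
apply: has_mean_indic.
  by apply: measurableI; exact: measurable_exceed.
have [_ _ indep] := henv.
pose B z : set R := if z == x then `]u, +oo[ else `]v, +oo[.
have := indep [:: x; y] _ B.
rewrite /= inE xy => /(_ isT).
rewrite !big_cons big_nil mule1 /B eqxx eq_sym (negbTE xy) !prob_exceed// EFinM => <-.
  congr (P _); apply/seteqP; split => w /=.
    move=> [wx wy] z /=; rewrite !inE => /orP[] /eqP ->; first by rewrite eqxx.
    by rewrite eq_sym (negbTE xy).
  move=> h; split.
    by have := h x; rewrite /= !inE eqxx => /(_ isT).
  by have := h y; rewrite /= !inE eqxx orbT eq_sym (negbTE xy) => /(_ isT).
by move=> z; case: ifP.
Qed.

Definition all_below (r : nat) (u : R) (w : Omega) : R := [forall i : 'I_r, tau i w <= u]%R%:R.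

Lemma has_mean_all_below r u : 1 <= u ->
  has_mean P (all_below r u) ((1 - powR u (- alpha)) ^+ r).
Proof.
move=> u1; have [_ _ indep] := henv.
pose s : seq int := map Posz (iota 0 r).
pose A : set Omega := \bigcap_(x in [set` s]) (tau x @^-1` `]-oo, u]).
have mA x : measurable (tau x @^-1` `]-oo, u]).
  by rewrite -[X in measurable X]setTI; apply: mtau.
have -> : all_below r u = \1_A.
  apply/funext => w; rewrite indicE; congr (nat_of_bool _)%:R; apply/idP/idP.
    move/forallP => h; rewrite inE => x /= /mapP[i]; rewrite mem_iota add0n => /= ir ->.
    by rewrite in_itv/=; exact: (h (Ordinal ir)).
  rewrite inE => h; apply/forallP => i; have := h (Posz i).
  by rewrite /= in_itv/=; apply; apply/mapP; exists (i : nat); rewrite ?mem_iota/=.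
apply: has_mean_indic.
  by apply: fin_bigcap_measurable => //; exact: finite_seq.
rewrite indep//; last by rewrite map_inj_uniq ?iota_uniq// => i j [].
rewrite (eq_bigr (fun=> (1 - powR u (- alpha))%:E)); last first.
  move=> x _; rewrite EFinB -(prob_exceed x u1) -probability_setC; last exact: measurable_exceed.
  congr (P _); apply/seteqP; split => w; rewrite /exceed_set /= !in_itv/= andbT.
    by rewrite leNgt => /negP.
  by move/negP; rewrite leNgt.
have -> : r = size s by rewrite size_map size_iota.
elim: (s) => [|x s' IHs]; first by rewrite big_nil expr0.
by rewrite big_cons IHs/= exprS EFinM.
Qed.

End Environment.

(** * Moments of inverse volumes *)

Section VolumeMoments.
Context (R : realType) d (Omega : measurableType d) (P : probability Omega R).
Variables (alpha : R) (tau : int -> Omega -> R).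
Hypothesis henv : pareto_iid_env P alpha tau.

Let mtau x : measurable_fun setT (tau x). Proof. by case: henv. Qed.
Let env w : int -> R := fun x => tau x w.

(* The inverses are written as powers because [powR] is nonnegative everywhere. *)
Definition inv_half_volume (r : nat) (w : Omega) : R :=
  powR (half_volume (fun x => tau x w) r) (-1).

Definition inv_volume (r : nat) (c : R) (w : Omega) : R :=
  powR (volume (fun x => tau x w) r + c) (-1).

Lemma measurable_half_volume r : measurable_fun setT (fun w => half_volume (env w) r).
Proof. by apply: measurable_sum => i; exact: mtau. Qed.

Lemma measurable_volume r : measurable_fun setT (fun w => volume (env w) r).
Proof.
apply: measurable_funD; first exact: measurable_half_volume.
by apply: measurable_sum => i; exact: mtau.
Qed.

Lemma has_mean_inv_half_volume r : (0 < r)%N -> exists m, has_mean P (inv_half_volume r) m.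
Proof.
move=> r0; apply: (@has_mean_bounded _ _ _ _ _ 1) => //.
- exact: measurableT_comp (measurable_powR _) (measurable_half_volume r).
- by move=> w; exact: powR_ge0.
apply: filterS (env_ge1_ae henv) => w w1; rewrite /inv_half_volume.
have V0 := half_volume_gt0 w1 r0.
rewrite powR_inv1 ?(ltW V0)// invf_le1//.
by apply: le_trans (half_volume_ge w1 r); rewrite ler1n.
Qed.

Lemma volume_ge1 w r : (forall x, 1 <= env w x) -> (0 < r)%N -> 1 <= volume (env w) r.
Proof.
move=> w1 r0; apply: (@le_trans _ _ (half_volume (env w) r)); last first.
  by rewrite lerDl ltW// half_volume_gt0// => x; exact: w1.
by apply: le_trans (half_volume_ge w1 r); rewrite ler1n.
Qed.

Lemma has_mean_inv_volume r c : (0 < r)%N -> 0 <= c -> exists m, has_mean P (inv_volume r c) m.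
Proof.
move=> r0 c0; apply: (@has_mean_bounded _ _ _ _ _ 1) => //.
- apply: measurableT_comp (measurable_powR _) _.
  by apply: measurable_funD; [exact: measurable_volume|exact: measurable_cst].
- by move=> w; exact: powR_ge0.
apply: filterS (env_ge1_ae henv) => w w1; rewrite /inv_volume.
have V0 := volume_ge1 w1 r0.
have V1 : 1 <= volume (env w) r + c by lra.
rewrite powR_inv1; last exact: le_trans V1.
by rewrite invf_le1// (lt_le_trans ltr01).
Qed.

Lemma powR_expr (a b : R) k : 0 <= a -> powR (a ^+ k) b = powR a b ^+ k.
Proof.
move=> a0; rewrite -(powR_mulrn _ a0) -powRrM mulrC powRrM.
by rewrite powR_mulrn// powR_ge0.
Qed.

Let beta : R := powR 2 (- alpha).

Lemma has_mean_exceed_dyadic x k : has_mean P (exceed tau x (2 ^+ k)) (beta ^+ k).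
Proof.
rewrite /beta -powR_expr//; apply: has_mean_exceed => //.
by rewrite exprn_ege1// ler1n.
Qed.

Lemma has_mean_dyadic x K :
  has_mean P (fun w => \sum_(0 <= k < K) 2 ^+ k * exceed tau x (2 ^+ k) w)
    (\sum_(0 <= k < K) (2 * beta) ^+ k).
Proof.
apply: has_mean_sum => k; rewrite exprMn.
by apply: has_meanZ; [exact: exprn_ge0|exact: has_mean_exceed_dyadic].
Qed.

Let sites r : seq int := [seq Posz i | i <- index_iota 0 r] ++ [seq - Posz i | i <- index_iota 0 r].

Lemma volumeE f r : volume f r = \sum_(x <- sites r) f x :> R.
Proof. by rewrite /volume /sites big_cat !big_map. Qed.

Lemma sum_sites r (c : R) : \sum_(x <- sites r) c = 2 * r%:R * c.
Proof.
by rewrite /sites big_cat !big_map/= sumr_const_nat subn0 -mulr_natr; ring.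
Qed.

(* 1/(W + c) >= (1 - Z/a - B)/(a + c), where Z dominates the volume W unless some trap exceeds
   2^K, and B counts the traps that do. *)
Lemma inv_volume_mean_ge K r c m : (0 < r)%N -> 0 <= c ->
  2 * r%:R * beta ^+ K <= 4^-1 -> has_mean P (inv_volume r c) m ->
  (2 * (4 * (2 * r%:R * (1 + \sum_(0 <= k < K) (2 * beta) ^+ k)) + c))^-1 <= m.
Proof.
(* With this [a], Z/a has mean 1/4, and B has mean at most 1/4 by [rK]; half of 1/(a + c)
   survives. *)
move=> r0 c0 rK hm; set z := 2 * r%:R * _; pose a := 4 * z.
have r0' : 0 < r%:R :> R by rewrite ltr0n.
have beta0 : 0 <= beta by exact: powR_ge0.
have z0 : 0 < z.
  rewrite !mulr_gt0// ltr_pwDl//; apply: sumr_ge0 => k _.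
  by rewrite exprn_ge0// mulr_ge0.
have a0 : 0 < a by rewrite mulr_gt0.
have ac0 : 0 < a + c by lra.
pose Z w := \sum_(x <- sites r) (1 + \sum_(0 <= k < K) 2 ^+ k * exceed tau x (2 ^+ k) w).
have hZ : has_mean P Z z.
  rewrite /z -sum_sites; apply: has_mean_sum => x.
  by apply: has_meanD; [exact: has_mean_cst|exact: has_mean_dyadic].
pose B w := \sum_(x <- sites r) exceed tau x (2 ^+ K) w.
have hB : has_mean P B (2 * r%:R * beta ^+ K).
  by rewrite -sum_sites; apply: has_mean_sum => x; exact: has_mean_exceed_dyadic.
have inv_ge0 : 0 <= (a + c)^-1 by rewrite invr_ge0 ltW.
have hL := has_mean_cst P inv_ge0.
have a_ge0 : 0 <= a^-1 by rewrite invr_ge0 ltW.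
have hR := has_meanD hm (has_meanZ inv_ge0 (has_meanD (has_meanZ a_ge0 hZ) hB)).
suff /(has_mean_le hL hR) : {ae P, forall w, (a + c)^-1 <=
    inv_volume r c w + (a + c)^-1 * (a^-1 * Z w + B w)}.
  have -> : a^-1 * z = 4^-1 by rewrite /a; field; rewrite lt0r_neq0.
  have : (a + c)^-1 * (4^-1 + 2 * r%:R * beta ^+ K) <= (a + c)^-1 * 2^-1.
    by rewrite ler_wpM2l//; lra.
  rewrite invfM; lra.
apply: filterS (env_ge1_ae henv) => w w1.
have V1 := volume_ge1 w1 r0.
rewrite /inv_volume powR_inv1; last by apply: addr_ge0 => //; exact: le_trans V1.
have A0 : 0 < volume (env w) r + c by lra.
have Ai0 : 0 <= (volume (env w) r + c)^-1 by rewrite invr_ge0 ltW.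
have B0 : 0 <= B w by case: hB.
have Z0 : 0 <= a^-1 * Z w by rewrite mulr_ge0//; case: hZ.
have big : 1 <= a^-1 * Z w + B w -> (a + c)^-1 <=
    (volume (env w) r + c)^-1 + (a + c)^-1 * (a^-1 * Z w + B w).
  move=> h1; apply: (@le_trans _ _ ((a + c)^-1 * (a^-1 * Z w + B w))); last lra.
  by rewrite ler_peMr.
have [hasw|/hasPn allw] := boolP (has (fun x => 2 ^+ K < tau x w) (sites r)).
  apply: big; suff : 1 <= B w by lra.
  rewrite /B; elim: (sites r) hasw => [//|x s IHs] /=.
  rewrite big_cons /exceed => /orP[->|/IHs]; last first.
    by move=> h; apply: le_trans h _; rewrite lerDr; case: (_ < _).
  by rewrite lerDl; apply: sumr_ge0 => y _; case: (_ < _).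
have WZ : volume (env w) r <= Z w.
  rewrite volumeE /Z !big_seq; apply: ler_sum => x /allw.
  by rewrite -leNgt => /dyadic_upper.
have [aZ|Za] := leP a (Z w).
  by apply: big; suff : 1 <= a^-1 * Z w; [lra|rewrite mulrC ler_pdivlMr// mul1r].
apply: (@le_trans _ _ (volume (env w) r + c)^-1); last first.
  by rewrite lerDl mulr_ge0// addr_ge0.
by rewrite lef_pV2 ?posrE//; lra.
Qed.

(* Second moment method: the dyadic truncations add up to a variable SY <= 2V of mean M = rK, and
   where SY < M/2 the trivial bound V >= r is good enough. *)
Lemma inv_half_volume_mean_le_crit r K m : (0 < r)%N -> (0 < K)%N -> beta = 2^-1 ->
  2 ^+ K <= 2 * r%:R :> R ->
  has_mean P (inv_half_volume r) m -> m <= 36 / (r%:R * K%:R).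
Proof.
move=> r0 K0 b2 Kr hm.
have r0' : 0 < r%:R :> R by rewrite ltr0n.
have K0' : 0 < K%:R :> R by rewrite ltr0n.
have bk : 2 * beta = 1 by rewrite b2 divff.
pose Y (i : nat) w := \sum_(0 <= k < K) 2 ^+ k * exceed tau (Posz i) (2 ^+ k) w.
have sumK : \sum_(0 <= k < K) (2 * beta) ^+ k = K%:R.
  by rewrite bk (eq_bigr (fun=> 1)) ?sumr_const_nat ?subn0// => k _; rewrite expr1n.
have hY i : has_mean P (Y i) K%:R by rewrite -sumK; exact: has_mean_dyadic.
have hYY i j : i != j -> has_mean P (fun w => Y i w * Y j w) (K%:R * K%:R).
  move=> ij; rewrite -sumK big_distrlr/=.
  rewrite (_ : (fun w => _) = fun w => \sum_(0 <= k < K) \sum_(0 <= l < K)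
     (2 ^+ k * 2 ^+ l) *
     (exceed tau (Posz i) (2 ^+ k) w * exceed tau (Posz j) (2 ^+ l) w)); last first.
    apply/funext => w; rewrite /Y big_distrlr/=; apply: eq_bigr => k _.
    by apply: eq_bigr => l _; ring.
  apply: has_mean_sum => k; apply: has_mean_sum => l.
  have -> : (2 * beta) ^+ k * (2 * beta) ^+ l = (2 ^+ k * 2 ^+ l) * (beta ^+ k * beta ^+ l).
    by rewrite !exprMn; ring.
  apply: has_meanZ; first by rewrite mulr_ge0// exprn_ge0.
  rewrite /beta -!powR_expr//.
  by apply: (has_mean_exceed2 henv) => //; rewrite exprn_ege1// ler1n.
pose D (i : nat) w := \sum_(0 <= k < K) 4 ^+ k.+1 * exceed tau (Posz i) (2 ^+ k) w.
pose dm : R := \sum_(0 <= k < K) 4 ^+ k.+1 * beta ^+ k.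
have hD i : has_mean P (D i) dm.
  by apply: has_mean_sum => k; apply: has_meanZ; [exact: exprn_ge0|exact: has_mean_exceed_dyadic].
have dm_le : dm <= 4 * 2 ^+ K.
  rewrite /dm (eq_bigr (fun k : nat => 4 * 2 ^+ k)); last first.
    by move=> k _; rewrite exprS -mulrA -exprMn b2; congr (_ * _ ^+ _); lra.
  by rewrite -mulr_sumr sum_expr2 ler_pM2l//; lra.
(* Expansion of the square of SY: independence factorizes the off-diagonal means, and [D i]
   dominates the square of [Y i]. *)
pose f i j w := if i == j then D i w else Y i w * Y j w.
pose fm (i j : nat) : R := if i == j then dm else K%:R * K%:R.
pose Q w := \sum_(0 <= i < r) \sum_(0 <= j < r) f i j w.
have hQ : has_mean P Q (\sum_(0 <= i < r) \sum_(0 <= j < r) fm i j).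
  apply: has_mean_sum => i; apply: has_mean_sum => j; rewrite /f /fm.
  by case: eqVneq => [_|ij]; [exact: hD|exact: hYY].
set qm := (X in has_mean P Q X) in hQ.
have dm0 : 0 <= dm := has_mean_ge0 (hD 0%N).
have qm_le : qm <= r%:R * dm + (r%:R * K%:R) ^+ 2.
  apply: (@le_trans _ _ (\sum_(0 <= i < r) (dm + r%:R * (K%:R * K%:R)))); last first.
    by rewrite sumr_const_nat subn0 -mulr_natr expr2; lra.
  rewrite /qm !big_nat; apply: ler_sum => i ir.
  apply: (@le_trans _ _ (\sum_(0 <= j < r) ((if j == i then dm else 0) + K%:R * K%:R))).
    apply: ler_sum => j _; rewrite /fm eq_sym; case: eqP => _; last by rewrite add0r.
    by rewrite lerDl mulr_ge0// ltW.
  have -> : \sum_(0 <= j < r) ((if j == i then dm else 0) + K%:R * K%:R) =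
     \sum_(0 <= j < r | j == i) dm + r%:R * (K%:R * K%:R).
    by rewrite [LHS]big_split/= [X in _ + X]sumr_const_nat subn0 -[X in _ + X]mulr_natl -big_mkcond.
  rewrite lerD2r big_mkcond (bigD1_seq i) ?iota_uniq ?mem_index_iota//=.
  by rewrite eqxx big1 ?addr0// => j /negbTE ->.
pose M : R := r%:R * K%:R; have M0 : 0 < M by rewrite mulr_gt0.
pose SY w := \sum_(0 <= i < r) Y i w.
have hSY : has_mean P SY M.
  rewrite /M (_ : r%:R * K%:R = \sum_(0 <= i < r) K%:R).
    by apply: has_mean_sum.
  by rewrite sumr_const_nat subn0 mulr_natl.
have c1 : 0 <= 8 / (r%:R * M) by rewrite divr_ge0// mulr_ge0// ltW.
have c2 : 0 <= 4 / (r%:R * M ^+ 2) by rewrite divr_ge0// mulr_ge0 ?exprn_ge0// ltW.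
have c3 : 0 <= 4 / M + 4 / r%:R by rewrite addr_ge0// divr_ge0// ltW.
(* Means are taken of nonnegative functions only, so the cross term of (SY - M)^2 is moved to the
   left. *)
have hL := has_meanD hm (has_meanZ c1 hSY).
have hR := has_meanD (has_mean_cst P c3) (has_meanZ c2 hQ).
suff /(has_mean_le hL hR) h : {ae P, forall w, inv_half_volume r w + 8 / (r%:R * M) * SY w <=
   4 / M + 4 / r%:R + 4 / (r%:R * M ^+ 2) * Q w}.
  (* The excess of [qm] over M^2 is at most r [dm] <= 8 r^2, which contributes 32/(M K). *)
  have h1 : 4 / (r%:R * M ^+ 2) * qm <= 4 / (r%:R * M ^+ 2) * (r%:R * (4 * (2 * r%:R)) + M ^+ 2).
    rewrite ler_wpM2l//; apply: le_trans qm_le _; rewrite lerD2r ler_pM2l//; lra.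
  have h2 : 4 / (r%:R * M ^+ 2) * (r%:R * (4 * (2 * r%:R)) + M ^+ 2) = 32 / (M * K%:R) + 4 / r%:R.
    by rewrite /M; field; rewrite !lt0r_neq0.
  have h3 : 8 / (r%:R * M) * M = 8 / r%:R by field; rewrite !lt0r_neq0.
  have h4 : 32 / (M * K%:R) <= 32 / M.
    by rewrite ler_pM2l// lef_pV2 ?posrE ?mulr_gt0// ler_peMr ?ler1n// ltW.
  rewrite -/M; move: h; rewrite h3; rewrite h2 in h1.
  have -> : 36 / M = 32 / M + 4 / M by field; rewrite lt0r_neq0.
  have -> : 8 / r%:R = 4 / r%:R + 4 / r%:R :> R by field; rewrite lt0r_neq0.
  by lra.
apply: filterS (env_ge1_ae henv) => w w1.
have Vr := half_volume_ge w1 r.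
have V0 := half_volume_gt0 w1 r0.
rewrite /inv_half_volume powR_inv1 ?(ltW V0)//.
set V := half_volume _ _ in Vr V0 *.
have YV : SY w <= 2 * V.
  rewrite /SY /V /half_volume mulr_sumr; apply: ler_sum => i _.
  by apply: dyadic_lower; exact: le_trans (w1 _).
have YQ : SY w ^+ 2 <= Q w.
  rewrite expr2 /SY big_distrlr/=; apply: ler_sum => i _; apply: ler_sum => j _.
  rewrite /f; case: eqVneq => [<-|//]; rewrite -expr2; exact: dyadic_sqr.
(* If SY >= M/2 then V >= M/4; otherwise (SY - M)^2 >= M^2/4 and the quadratic term alone is at
   least 1/r. *)
have key : V^-1 <= 4 / M + 4 / (r%:R * M ^+ 2) * (SY w - M) ^+ 2.
  have [YM|MY] := leP (M / 2) (SY w).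
    apply: (@le_trans _ _ (4 / M)); last by rewrite lerDl (mulr_ge0 c2)// sqr_ge0.
    have -> : 4 / M = (M / 4)^-1 by field; rewrite lt0r_neq0.
    rewrite lef_pV2 ?posrE ?divr_gt0//; lra.
  apply: (@le_trans _ _ (4 / (r%:R * M ^+ 2) * (M / 2) ^+ 2)).
    have -> : 4 / (r%:R * M ^+ 2) * (M / 2) ^+ 2 = r%:R^-1 by field; rewrite !lt0r_neq0.
    by rewrite lef_pV2.
  apply: (@le_trans _ _ (4 / (r%:R * M ^+ 2) * (SY w - M) ^+ 2)); last first.
    by rewrite lerDr divr_ge0// ltW.
  rewrite ler_wpM2l// -subr_ge0.
  have -> : (SY w - M) ^+ 2 - (M / 2) ^+ 2 = (M / 2 - SY w) * (3 / 2 * M - SY w) by field.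
  by rewrite mulr_ge0//; lra.
have h1 : 4 / (r%:R * M ^+ 2) * SY w ^+ 2 <= 4 / (r%:R * M ^+ 2) * Q w by rewrite ler_wpM2l.
have h2 : 4 / (r%:R * M ^+ 2) * (SY w - M) ^+ 2 =
   4 / (r%:R * M ^+ 2) * SY w ^+ 2 - 8 / (r%:R * M) * SY w + 4 / r%:R.
  by field; rewrite !lt0r_neq0.
by lra.
Qed.

End VolumeMoments.

(** * Volume moments in the three regimes of alpha *)

Section Scales.
Context (R : realType) d (Omega : measurableType d) (P : probability Omega R).
Variables (alpha : R) (tau : int -> Omega -> R).
Hypothesis alpha0 : 0 < alpha.
Hypothesis henv : pareto_iid_env P alpha tau.

Lemma powR_ge1 (x a : R) : 1 <= x -> 0 <= a -> 1 <= powR x a.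
Proof.
move=> x1 a0; apply: (@le_trans _ _ (powR 1 a)); first by rewrite powR1.
by apply: ge0_ler_powR; rewrite ?nnegrE// (le_trans _ x1).
Qed.

Lemma gt1_ltr_powR (x a b : R) : 1 < x -> a < b -> powR x a < powR x b.
Proof.
move=> x1 ab; have x0 : 0 < x := lt_trans ltr01 x1.
have -> : b = a + (b - a) by ring.
rewrite powRD ?(gt_eqF x0) ?implybT// ltr_pMr ?powR_gt0//.
have ba : 0 < b - a by rewrite subr_gt0.
by have := gt0_ltr_powR ba _ _ x1; rewrite powR1; apply; rewrite nnegrE// ltW.
Qed.

(** Bernoulli's inequality, used to see that powers of g > 1 are unbounded. *)
Lemma geometric_ge1D (g : R) n : 1 <= g -> 1 + n%:R * (g - 1) <= g ^+ n.
Proof.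
move=> g1; elim: n => [|n IHn]; first by rewrite mul0r addr0.
rewrite exprS -natr1; apply: (@le_trans _ _ (g * (1 + n%:R * (g - 1)))).
  rewrite -subr_ge0 (_ : _ - _ = n%:R * (g - 1) ^+ 2); first by rewrite mulr_ge0// sqr_ge0.
  by ring.
by rewrite ler_pM2l// (lt_le_trans ltr01).
Qed.

Lemma geometric_least (g x : R) : 1 < g ->
  exists K, x <= g ^+ K /\ forall k, (k < K)%N -> g ^+ k < x.
Proof.
move=> g1; have ex : exists n, x <= g ^+ n.
  exists (Num.bound (`|x| / (g - 1))).
  have g0 : 0 < g - 1 by rewrite subr_gt0.
  apply: le_trans (geometric_ge1D _ (ltW g1)).
  have /archi_boundP : 0 <= `|x| / (g - 1) by rewrite divr_ge0// ltW.
  rewrite ltr_pdivrMr// => h; have := ler_norm x; lra.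
exists (ex_minn ex); case: ex_minnP => K xK Kmin; split => // k kK.
by rewrite ltNge; apply/negP => /Kmin; rewrite leqNgt kK.
Qed.

Let gamma : R := powR 2 alpha.

Let gamma_gt1 : 1 < gamma.
Proof.
rewrite /gamma; have := @gt0_ltr_powR _ alpha alpha0 1 2.
by rewrite powR1; apply; rewrite ?nnegrE ?ltr1n.
Qed.

Let gammaX k : powR (2 ^+ k) alpha = gamma ^+ k.
Proof. exact: powR_expr. Qed.

Let betaE : powR 2 (- alpha) = gamma^-1. Proof. exact: powRN. Qed.

(* v/V is cut into dyadic layers: V <= v/2^k forces all r traps below v/2^k, which has probability
   at most exp(-gamma^k). *)
Lemma inv_half_volume_mean_le_sub : exists2 C, 0 < C & forall r m, (0 < r)%N ->
  has_mean P (inv_half_volume tau r) m -> m <= C / powR r%:R alpha^-1.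
Proof.
(* Since gamma^n >= 4, the Taylor term of order n + 1 of exp(gamma^k) is at least 4^k/F; it beats
   the layer weight 2^(k+1) and leaves a geometric series of sum at most 4F. *)
have [n [gn _]] := geometric_least 4 gamma_gt1.
pose F : R := n.+1`!%:R; have F0 : 0 < F by rewrite ltr0n fact_gt0.
exists (1 + 4 * F); first by rewrite addr_gt0// mulr_gt0.
move=> r m r0 hm; set v := powR _ _.
have r1 : 1 <= r%:R :> R by rewrite ler1n.
have v1 : 1 <= v by rewrite powR_ge1// invr_ge0 ltW.
have v0 : 0 < v := lt_le_trans ltr01 v1.
have va : powR v alpha = r%:R by rewrite /v -powRrM mulVf ?lt0r_neq0// powRr1.
have [K [vK Kmin]] := @geometric_least 2 v (ltr1n _ 2).
(* The tail law is given for levels at least 1; for k < K the maximum is v/2^k. *)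
pose u k := Num.max 1 (v / 2 ^+ k).
have u1 k : 1 <= u k by rewrite le_max lexx.
have p2 k : 0 < 2 ^+ k :> R by rewrite exprn_gt0.
have hR : has_mean P (fun w => 1 + \sum_(0 <= k < K) 2 ^+ k.+1 * all_below tau r (u k) w)
   (1 + \sum_(0 <= k < K) 2 ^+ k.+1 * (1 - powR (u k) (- alpha)) ^+ r).
  apply: has_meanD; first exact: has_mean_cst.
  apply: has_mean_sum => k; apply: has_meanZ; first exact: exprn_ge0.
  by apply: (has_mean_all_below henv).
have /(has_mean_le (has_meanZ (ltW v0) hm) hR) h : {ae P, forall w,
   v * inv_half_volume tau r w <= 1 + \sum_(0 <= k < K) 2 ^+ k.+1 * all_below tau r (u k) w}.
  apply: filterS (env_ge1_ae henv) => w w1.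
  have V0 := half_volume_gt0 w1 r0.
  rewrite /inv_half_volume powR_inv1 ?(ltW V0)//; set V := half_volume _ _ in V0 *.
  have V1 : 1 <= V by apply: le_trans (half_volume_ge w1 r).
  have /dyadic_layers h : v / V <= 2 ^+ K.
    by apply: le_trans vK; rewrite ler_pdivrMr// ler_peMr// ltW.
  apply: le_trans h _; rewrite lerD2l !big_nat; apply: ler_sum => k /andP[_ kK].
  rewrite ler_pM2l ?exprn_gt0//.
  have ab0 : 0 <= all_below tau r (u k) w by rewrite /all_below; case: [forall _, _].
  have [kV|//] := leP (2 ^+ k) (v / V).
  suff -> : all_below tau r (u k) w = 1 by [].
  rewrite /all_below; case: forallP => // nall; exfalso; apply: nall => i.
  rewrite le_max; apply/orP; right.
  rewrite ler_pdivlMr//; rewrite ler_pdivlMr// in kV; apply: le_trans kV.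
  rewrite mulrC ler_pM2l// /V /half_volume big_mkord (bigD1 i)//= lerDl.
  by apply: sumr_ge0 => j _; exact: le_trans (w1 _).
rewrite ler_pdivlMr// mulrC; apply: le_trans h _; rewrite lerD2l.
apply: (@le_trans _ _ (\sum_(0 <= k < K) 2 * F * 2^-1 ^+ k)).
  rewrite !big_nat; apply: ler_sum => k /andP[_ /Kmin kv].
  have uE : u k = v / 2 ^+ k.
    by rewrite /u max_r// ler_pdivlMr// mul1r ltW.
  have g0 j : 0 < gamma ^+ j by rewrite exprn_gt0// (lt_trans ltr01).
  have uk0 : 0 <= v / 2 ^+ k by rewrite divr_ge0// ?ltW.
  have uv : powR (u k) alpha * gamma ^+ k = r%:R.
    by rewrite uE -gammaX -powRM ?divfK ?(ltW (p2 k))// lt0r_neq0.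
  have pE : powR (u k) (- alpha) = gamma ^+ k / r%:R.
    have U0 : powR (u k) alpha != 0 by apply/eqP => U0; move: uv r1; rewrite U0 mul0r => <-; lra.
    by rewrite powRN -uv; field; rewrite U0 lt0r_neq0.
  have p1 : powR (u k) (- alpha) <= 1.
    have U1 := powR_ge1 (u1 k) (ltW alpha0).
    by rewrite powRN invf_le1// (lt_le_trans ltr01).
  (* 1 - p <= exp(-p), with r p = gamma^k because v^alpha = r. *)
  apply: (@le_trans _ _ (2 ^+ k.+1 * expR (- gamma ^+ k))).
    rewrite ler_pM2l//.
    have -> : - gamma ^+ k = r%:R * (- powR (u k) (- alpha)).
      by rewrite pE; field; rewrite lt0r_neq0// ltr0n.
    rewrite expRM_natl; apply: lerXn2r; rewrite ?nnegrE ?subr_ge0 ?expR_ge0//.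
    exact: expR_ge1Dx.
  rewrite expRN; have := expR_ge1Dxn n (ltW (g0 k)).
  rewrite -/F => hexp.
  have h4 : 4 ^+ k / F <= expR (gamma ^+ k).
    apply: le_trans hexp; apply: (@le_trans _ _ ((gamma ^+ k) ^+ n.+1 / F)); last lra.
    rewrite ler_pM2r ?invr_gt0// -exprM mulnC exprM.
    apply: lerXn2r; rewrite ?nnegrE ?(ltW (g0 _))//; apply: le_trans gn _.
    by rewrite ler_weXn2l// ltW.
  apply: (@le_trans _ _ (2 ^+ k.+1 * (4 ^+ k / F)^-1)).
    by rewrite ler_pM2l// lef_pV2 ?posrE ?expR_gt0 ?divr_gt0 ?exprn_gt0.
  have -> : 4 ^+ k = 2 ^+ k * 2 ^+ k :> R by rewrite -exprMn; congr (_ ^+ _); ring.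
  rewrite exprS exprVn le_eqVlt; apply/orP; left; apply/eqP; field.
  by rewrite !lt0r_neq0.
rewrite -mulr_sumr; suff : \sum_(0 <= i < K) 2^-1 ^+ i <= 2 :> R.
  move=> hs; apply: (@le_trans _ _ (2 * F * 2)); last lra.
  by rewrite ler_pM2l// mulr_gt0.
have := subrX1 (2^-1 : R) K; rewrite big_mkord.
have : 0 <= 2^-1 ^+ K :> R by rewrite exprn_ge0.
lra.
Qed.

(** K is least with gamma^K >= 8r: this makes the expected number of traps above 2^K at most 1/4,
    and minimality keeps gamma^K of order r. *)
Lemma inv_volume_mean_ge_least : exists K : nat -> nat, forall r, (0 < r)%N ->
  [/\ 8 * r%:R <= gamma ^+ K r, gamma ^+ K r <= 8 * gamma * r%:R & forall c m, 0 <= c ->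
  has_mean P (inv_volume tau r c) m ->
  (2 * (4 * (2 * r%:R * (1 + \sum_(0 <= k < K r) (2 * gamma^-1) ^+ k)) + c))^-1 <= m].
Proof.
have ex r := geometric_least (8 * r%:R) gamma_gt1.
exists (fun r => projT1 (cid (ex r))) => r r0; case: cid => K /= [rK Kmin].
have r1 : 1 <= r%:R :> R by rewrite ler1n.
have g0 : 0 < gamma := lt_trans ltr01 gamma_gt1.
have K0 : (0 < K)%N by case: K rK {Kmin} => //; rewrite expr0; lra.
split => //.
  rewrite -(prednK K0) exprS; have := Kmin K.-1; rewrite ltn_predL => /(_ K0) h.
  have -> : 8 * gamma * r%:R = gamma * (8 * r%:R) by ring.
  by rewrite ler_pM2l// ltW.
move=> c m c0 hm; rewrite -betaE; apply: (inv_volume_mean_ge henv) hm => //.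
rewrite betaE exprVn ler_pdivrMr ?exprn_gt0//; lra.
Qed.

(** The ratio q = 2/gamma exceeds 1, so the sum is of the order of q^K; there 2^K =
    (gamma^K)^(1/alpha) is of order r^(1/alpha). *)
Lemma inv_volume_mean_ge_sub : alpha < 1 ->
  exists2 C, 0 < C & forall r c m, (0 < r)%N -> 0 <= c ->
  has_mean P (inv_volume tau r c) m -> (2 * (C * powR r%:R alpha^-1 + c))^-1 <= m.
Proof.
move=> a1; have [K hK] := inv_volume_mean_ge_least.
pose q := 2 * gamma^-1.
have g0 : 0 < gamma := lt_trans ltr01 gamma_gt1.
have q1 : 1 < q.
  rewrite /q ltr_pdivlMr// mul1r /gamma -[ltRHS](@powRr1 R 2)//.
  by apply: gt1_ltr_powR => //; rewrite ltr1n.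
pose D := powR (8 * gamma) alpha^-1.
have D0 : 0 < D by rewrite powR_gt0// mulr_gt0.
exists (8 * (1 + D / (8 * (q - 1)))).
  by rewrite mulr_gt0// addr_gt0// divr_gt0// mulr_gt0// subr_gt0.
move=> r c m r0 c0 hm; have [rK Kr /(_ c m c0 hm)] := hK r r0.
apply: le_trans; set v := powR _ _.
have r1 : 1 <= r%:R :> R by rewrite ler1n.
have rv : r%:R <= v.
  rewrite /v -[leLHS](@powRr1 R)//; apply: ler_powR => //.
  by rewrite invf_ge1// ltW.
have s0 : 0 <= \sum_(0 <= k < K r) q ^+ k.
  by apply: sumr_ge0 => k _; rewrite exprn_ge0// ltW// (lt_trans ltr01).
have key : r%:R * (1 + \sum_(0 <= k < K r) q ^+ k) <= (1 + D / (8 * (q - 1))) * v.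
  rewrite mulrDr mulr1 mulrDl mul1r; apply: lerD => //.
  have q10 : 0 < q - 1 by rewrite subr_gt0.
  have sE : \sum_(0 <= k < K r) q ^+ k <= q ^+ K r / (q - 1).
    rewrite ler_pdivlMr// mulrC big_mkord -subrX1; lra.
  apply: le_trans (ler_wpM2l _ sE) _ => //.
  have qK : q ^+ K r <= D * v / (8 * r%:R).
    have K2 : 2 ^+ K r <= D * v.
      have -> : 2 ^+ K r = powR (gamma ^+ K r) alpha^-1.
        by rewrite powR_expr ?(ltW g0)// /gamma -powRrM mulfV ?lt0r_neq0// powRr1.
      rewrite /D /v -powRM ?mulr_ge0 ?(ltW g0)//.
      apply: ge0_ler_powR;
        by rewrite ?nnegrE ?invr_ge0 ?exprn_ge0 ?mulr_ge0 ?(ltW g0) ?(ltW alpha0).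
    rewrite /q exprMn exprVn; apply: ler_pM => //.
    - by rewrite invr_ge0 exprn_ge0// ltW.
    - by rewrite lef_pV2 ?posrE ?mulr_gt0 ?exprn_gt0// (lt_le_trans ltr01).
  have qi : 0 <= (q - 1)^-1 by rewrite invr_ge0 ltW.
  apply: le_trans (ler_wpM2l _ (ler_wpM2r qi qK)) _ => //.
  rewrite le_eqVlt; apply/orP; left; apply/eqP; field.
  by rewrite !lt0r_neq0// (lt_le_trans ltr01).
have z0 : 0 <= r%:R * (1 + \sum_(0 <= k < K r) q ^+ k) by rewrite mulr_ge0// addr_ge0.
have C0 : 0 < (1 + D / (8 * (q - 1))) * v.
  by apply: lt_le_trans key; rewrite mulr_gt0 ?(lt_le_trans ltr01 r1)// ltr_pwDl.
rewrite lef_pV2 ?posrE; [|nra|nra].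
by move: key; rewrite -/q; nra.
Qed.

(** Now 2/gamma < 1: the geometric series converges and the truncated mean volume is linear in r. *)
Lemma inv_volume_mean_ge_super : 1 < alpha ->
  exists2 C, 0 < C & forall r c m, (0 < r)%N -> 0 <= c ->
  has_mean P (inv_volume tau r c) m -> (2 * (C * r%:R + c))^-1 <= m.
Proof.
move=> a1; have [K hK] := inv_volume_mean_ge_least.
pose q := 2 * gamma^-1.
have g0 : 0 < gamma := lt_trans ltr01 gamma_gt1.
have q0 : 0 < q by rewrite mulr_gt0// invr_gt0.
have q1 : q < 1.
  rewrite /q ltr_pdivrMr// mul1r /gamma -[ltLHS](@powRr1 R 2)//.
  by apply: gt1_ltr_powR => //; rewrite ltr1n.
exists (8 * (1 + (1 - q)^-1)).
  by rewrite mulr_gt0// addr_gt0// invr_gt0 subr_gt0.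
move=> r c m r0 c0 hm; have [rK Kr /(_ c m c0 hm)] := hK r r0.
apply: le_trans; rewrite -/q.
have r1 : 0 < r%:R :> R by rewrite ltr0n.
have s0 : 0 <= \sum_(0 <= k < K r) q ^+ k by apply: sumr_ge0 => k _; rewrite exprn_ge0// ltW.
have sE : \sum_(0 <= k < K r) q ^+ k <= (1 - q)^-1.
  rewrite -[leRHS]mul1r ler_pdivlMr ?subr_gt0// big_mkord.
  have := subrX1 q (K r); have : 0 <= q ^+ K r by rewrite exprn_ge0// ltW.
  lra.
set S := \sum_(0 <= k < K r) _ in s0 sE *.
have h1 : r%:R * (1 + S) <= r%:R * (1 + (1 - q)^-1) by rewrite ler_pM2l// lerD2l.
have h2 : 0 < r%:R * (1 + S) by rewrite mulr_gt0// ltr_pwDl.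
by rewrite lef_pV2 ?posrE; lra.
Qed.

Lemma inv_half_volume_mean_le_super r m : (0 < r)%N ->
  has_mean P (inv_half_volume tau r) m -> m <= r%:R^-1.
Proof.
move=> r0 hm; have r1 : 0 < r%:R :> R by rewrite ltr0n.
have ri : 0 <= r%:R^-1 :> R by rewrite invr_ge0.
apply: (has_mean_le hm (has_mean_cst P ri)).
apply: filterS (env_ge1_ae henv) => w w1.
have V0 := half_volume_gt0 w1 r0.
rewrite /inv_half_volume powR_inv1 ?(ltW V0)// lef_pV2 ?posrE//.
exact: half_volume_ge.
Qed.

(** Integer version of r log r; the successor keeps it positive at r = 1. *)
Definition critical_scale (r : nat) : R := (r * (trunc_log 2 r).+1)%N%:R.

Lemma inv_half_volume_mean_le_critical r m : alpha = 1 -> (0 < r)%N ->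
  has_mean P (inv_half_volume tau r) m -> m <= 36 / critical_scale r.
Proof.
move=> a1 r0 hm; rewrite /critical_scale natrM.
apply: (inv_half_volume_mean_le_crit henv r0 (ltn0Sn _)) hm.
  by rewrite betaE /gamma a1 powRr1.
rewrite exprS ler_pM2l// -natrX ler_nat.
exact: trunc_logP.
Qed.

Lemma inv_volume_mean_ge_critical r c m : alpha = 1 -> (0 < r)%N -> 0 <= c ->
  has_mean P (inv_volume tau r c) m -> (2 * (40 * critical_scale r + c))^-1 <= m.
Proof.
move=> a1 r0 c0 hm; set L := trunc_log 2 r.
have r1 : 0 < r%:R :> R by rewrite ltr0n.
have b2 : powR 2 (- alpha) = 2^-1 by rewrite betaE /gamma a1 powRr1.
have rL : r%:R <= 2 ^+ L.+1 :> R.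
  by rewrite -natrX ler_nat ltnW// trunc_log_ltn.
have p2 : 0 < 2 ^+ L.+1 :> R by rewrite exprn_gt0.
(* As r <= 2^(L+1), three more levels bring 2r 2^(-K) down to 1/4; the constant 40 is 4 * 2 * 5,
   from L + 5 <= 5 (L + 1). *)
have := @inv_volume_mean_ge _ _ _ _ _ _ henv (L.+1 + 3)%N r c m r0 c0.
rewrite b2 divff// => /(_ _ hm) h.
apply: le_trans (h _); last first.
  rewrite exprVn exprD ler_pdivrMr ?mulr_gt0 ?exprn_gt0//.
  have -> : 2 ^+ 3 = 8 :> R by rewrite -natrX.
  lra.
have -> : \sum_(0 <= k < L.+1 + 3) 1 ^+ k = (L.+1 + 3)%:R :> R.
  by rewrite (eq_bigr (fun=> 1)) ?sumr_const_nat ?subn0// => k _; rewrite expr1n.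
rewrite /critical_scale natrM -/L natrD.
have L1 : 1 <= L.+1%:R :> R by rewrite ler1n.
have h1 : r%:R * (1 + (L.+1%:R + 3%:R)) <= r%:R * (5 * L.+1%:R) :> R.
  by rewrite ler_pM2l//; lra.
have h2 : 0 < r%:R * (1 + (L.+1%:R + 3%:R)) :> R by rewrite mulr_gt0//; lra.
by rewrite lef_pV2 ?posrE; lra.
Qed.

End Scales.

(** * Moments of the heat kernel *)

Lemma two_sided_of_bounds (R : realType) d (Omega : measurableType d) (P : probability Omega R)
    (alpha eps : R) (tau : int -> Omega -> R) (t0 c C : R) : 0 < c ->
  (forall t, t0 <= t -> (c%:E <= normalized_moment P alpha tau eps t <= C%:E)%E) ->
  two_sided_bound P alpha tau eps.
Proof.
move=> c0 h; rewrite /two_sided_bound; set f := normalized_moment _ _ _ _.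
pose V : set R := [set t | t0 <= t].
have FV : pinfty_nbhs R V by apply: nbhs_pinfty_ge; exact: num_real.
split.
- apply: (@lt_le_trans _ _ c%:E); first by rewrite lte_fin.
  rewrite limf_einfE; apply: (@le_trans _ _ (ereal_inf (f @` V))).
    by apply: le_ereal_inf_tmp => _ [t tV <-]; have /andP[] := h t tV.
  by apply: ereal_sup_ubound; exists V.
(* Any two neighbourhoods of infinity share a point t, and f t separates the infimum from the
   supremum. *)
- rewrite limf_einfE limf_esupE; apply: ge_ereal_sup => _ [A FA <-].
  apply: le_ereal_inf_tmp => _ [B FB <-].
  have [t [At Bt]] := filter_ex (filterI FA FB).
  apply: (@le_trans _ _ (f t)); first by apply: ereal_inf_lbound; exists t.
  by apply: ereal_sup_ubound; exists t.
- apply: (@le_lt_trans _ _ C%:E); last exact: ltry.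
  rewrite limf_esupE; apply: (@le_trans _ _ (ereal_sup (f @` V))).
    by apply: ereal_inf_lbound; exists V.
  by apply: ge_ereal_sup => _ [t tV <-]; have /andP[] := h t tV.
Qed.

Section HeatKernelMoment.
Context (R : realType) d (Omega : measurableType d) (P : probability Omega R).
Variables (alpha : R) (tau : int -> Omega -> R).
Hypothesis henv : pareto_iid_env P alpha tau.

Let env w : int -> R := fun x => tau x w.

Lemma measurable_env_inv (c : R) x : measurable_fun setT (fun w => (c * tau x w)^-1).
Proof.
have mt : measurable_fun setT (fun w => c * tau x w).
  apply: measurable_funM; first exact: measurable_cst.
  by case: henv.
(* Inversion is reduced to [powR] with exponent -1, whose measurability is at hand, by splitting on
   the sign. *)
have -> : (fun w => (c * tau x w)^-1) =
    (fun w => if 0 <= c * tau x w then powR (c * tau x w) (-1) else - powR (- (c * tau x w)) (-1)).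
  apply/funext => w; case: leP => h; first by rewrite powR_inv1.
  by rewrite powR_inv1 ?oppr_ge0 ?ltW// invrN opprK.
apply: measurable_fun_ifT.
- by apply: measurable_fun_ler => //; exact: measurable_cst.
- exact: measurableT_comp (measurable_powR _) mt.
- apply: measurable_funN; apply: measurableT_comp (measurable_powR _) _.
  exact: measurable_funN.
Qed.

Lemma measurable_heat_kernel t : measurable_fun setT (fun w => btm_heat_kernel (env w) t 0 0).
Proof.
have mpow n x : measurable_fun setT (fun w => btm_gen_pow (env w) n 0 x).
  elim: n x => [|n IHn] x; first exact: measurable_cst.
  rewrite /btm_gen_pow; under eq_fun do rewrite iterS.
  apply: measurable_funM; first exact: measurable_env_inv.
  by apply: measurable_funD; apply: measurable_funB; exact: IHn.
apply: measurable_funM.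
  apply: measurable_fun_limn => N; apply: measurable_sum => n.
  by apply: measurable_funM; [exact: measurable_cst|exact: mpow].
have -> : (fun w => (env w 0)^-1) = (fun w => (1 * tau 0 w)^-1).
  by apply/funext => w; rewrite mul1r.
exact: measurable_env_inv.
Qed.

(** The integrand of [normalized_moment] at exponent 1; [powR] makes it nonnegative for every w. *)
Definition heat_kernel_pow1 (t : R) (w : Omega) : R := powR (btm_heat_kernel (env w) t 0 0) 1.

Lemma heat_kernel_pow1E t w : 0 < t -> (forall x, 1 <= env w x) ->
  heat_kernel_pow1 t w = btm_heat_kernel (env w) t 0 0.
Proof.
by move=> t0 w1; rewrite /heat_kernel_pow1 powRr1// (heat_kernel_ge0 (tau := env w)).
Qed.

Lemma has_mean_heat_kernel t : 0 < t -> exists m, has_mean P (heat_kernel_pow1 t) m.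
Proof.
move=> t0; apply: (@has_mean_bounded _ _ _ _ _ (1 + 2 * 1 / t)).
- exact: measurableT_comp (measurable_powR _) (measurable_heat_kernel t).
- by move=> w; exact: powR_ge0.
- by rewrite addr_ge0// divr_ge0// ?mulr_ge0// ltW.
apply: filterS (env_ge1_ae henv) => w w1; rewrite heat_kernel_pow1E//.
apply: le_trans (heat_kernel_upper (tau := env w) w1 t0 (ltnSn 0)) _.
rewrite lerD2r invf_le1 ?half_volume_gt0//.
by apply: le_trans (half_volume_ge w1 1).
Qed.

Lemma normalized_momentE t m : has_mean P (heat_kernel_pow1 t) m ->
  0 <= phi_alpha alpha t ->
  normalized_moment P alpha tau 1 t = ((phi_alpha alpha t)^-1 * m)%:E.
Proof.
move=> [_ _ hm] p0; rewrite /normalized_moment powR_inv1// EFinM -hm.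
by [].
Qed.

(** * Two-sided moment bounds from an abstract volume scale v *)

Variables (v : nat -> R) (C1 C2 C3 T0 : R).
Hypothesis C1_gt0 : 0 < C1.
Hypothesis C2_gt0 : 0 < C2.
Hypothesis C3_gt0 : 0 < C3.
Hypothesis v_ge1 : forall r, (0 < r)%N -> 1 <= v r.
Hypothesis inv_half_volume_le : forall r m, (0 < r)%N ->
  has_mean P (inv_half_volume tau r) m -> m <= C1 / v r.
Hypothesis inv_volume_ge : forall r c m, (0 < r)%N -> 0 <= c ->
  has_mean P (inv_volume tau r c) m -> (2 * (C2 * v r + c))^-1 <= m.
Hypothesis v_doubling : forall k, (0 < k)%N ->
  exists2 C, 0 < C & forall r, (0 < r)%N -> v (k * r)%N <= C * v r.
Hypothesis v_phi : forall t, T0 <= t -> 0 < t /\ 0 < phi_alpha alpha t /\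
  exists2 r : nat, (0 < r)%N &
  [/\ v r <= C3 / phi_alpha alpha t, (phi_alpha alpha t)^-1 <= C3 * v r,
      r%:R <= C3 * (t * phi_alpha alpha t) & t <= C3 * (r%:R * v r)].

Lemma heat_kernel_mean_le t m r : 0 < t -> (0 < r)%N ->
  has_mean P (heat_kernel_pow1 t) m -> m <= C1 / v r + 2 * r%:R / t.
Proof.
move=> t0 r0 hm; have [a ha] := has_mean_inv_half_volume henv r0.
have b0 : 0 <= 2 * r%:R / t by rewrite divr_ge0// ?mulr_ge0// ltW.
apply: (@le_trans _ _ (a + 2 * r%:R / t)); last by rewrite lerD2r inv_half_volume_le.
apply: (has_mean_le hm (has_meanD ha (has_mean_cst P b0))).
apply: filterS (env_ge1_ae henv) => w w1; rewrite heat_kernel_pow1E//.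
rewrite /inv_half_volume powR_inv1; last exact: ltW (half_volume_gt0 w1 r0).
exact: (heat_kernel_upper (tau := env w)).
Qed.

Lemma heat_kernel_mean_ge t m r R0 N : 0 < t -> (0 < r)%N -> (0 < R0)%N -> (0 < N)%N ->
  has_mean P (heat_kernel_pow1 t) m ->
  (2 * (C2 * v R0 + N%:R / (2 * R0%:R)))^-1 <= m + (2 * t / N%:R * (C1 / v r) + 4 * r%:R / N%:R).
Proof.
move=> t0 r0 R00 N0 hm; have [a ha] := has_mean_inv_half_volume henv r0.
have c0 : 0 <= N%:R / (2 * R0%:R) :> R by rewrite divr_ge0// mulr_ge0.
have [b hb] := has_mean_inv_volume henv R00 c0.
have c1 : 0 <= 4 * r%:R / N%:R :> R by rewrite divr_ge0// mulr_ge0.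
have c2 : 0 <= 2 * t / N%:R by rewrite divr_ge0// mulr_ge0// ltW.
apply: le_trans (inv_volume_ge R00 c0 hb) _.
apply: (@le_trans _ _ (m + (2 * t / N%:R * a + 4 * r%:R / N%:R))); last first.
  by rewrite lerD2l lerD2r ler_wpM2l// inv_half_volume_le.
apply: (has_mean_le hb (has_meanD hm (has_meanD (has_meanZ c2 ha) (has_mean_cst P c1)))).
apply: filterS (env_ge1_ae henv) => w w1; rewrite heat_kernel_pow1E//.
have V0 := half_volume_gt0 w1 r0.
rewrite /inv_half_volume /inv_volume !powR_inv1 ?(ltW V0)//; last first.
  by rewrite addr_ge0// (le_trans _ (volume_ge1 w1 R00)).
have := heat_kernel_lower (tau := env w) w1 t0 r0 R00 N0.
set V := half_volume _ _ in V0 *.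
have -> : (2 * t / V + 4 * r%:R) / N%:R = 2 * t / N%:R * V^-1 + 4 * r%:R / N%:R.
  by field; rewrite !lt0r_neq0// ltr0n.
by rewrite lerBlDr.
Qed.

Lemma two_sided_of_scale : two_sided_bound P alpha tau 1.
Proof.
(* With w = v(kr), the main term will be 1/(2 (C2 + 1) w) and the errors at most (2 C1 C3 + 4)/(k
   w); this k makes the errors at most half of the main term. *)
pose k := (Num.bound (4 * (C2 + 1) * (2 * C1 * C3 + 4))).+1.
have kge : 4 * (C2 + 1) * (2 * C1 * C3 + 4) <= k%:R.
  apply: ltW; apply: (@lt_trans _ _ (Num.bound (4 * (C2 + 1) * (2 * C1 * C3 + 4)))%:R).
    by apply: archi_boundP; rewrite !mulr_ge0 ?addr_ge0 ?mulr_ge0 ?(ltW C1_gt0) ?(ltW C2_gt0) ?(ltW C3_gt0).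
  by rewrite ltr_nat.
have [Ck Ck0 vk] := v_doubling (ltn0Sn _ : (0 < k)%N).
pose D := 4 * (C2 + 1) * Ck * C3.
have C21 : 0 < C2 + 1 by rewrite addr_gt0.
have D0 : 0 < D by rewrite !mulr_gt0.
apply: (@two_sided_of_bounds _ _ _ _ _ _ _ T0 D^-1 (C1 * C3 + 2 * C3)).
  by rewrite invr_gt0.
move=> t /v_phi[t0 [p0 [r r0 [v1 v2 v3 v4]]]].
have [m hm] := has_mean_heat_kernel t0.
rewrite (normalized_momentE hm) ?(ltW p0)// !lee_fin.
set p := phi_alpha alpha t in p0 v1 v2 v3 *.
have vr0 : 0 < v r := lt_le_trans ltr01 (v_ge1 r0).
have r0' : 0 < r%:R :> R by rewrite ltr0n.
apply/andP; split; last first.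
  rewrite mulrC ler_pdivrMr//; apply: le_trans (heat_kernel_mean_le t0 r0 hm) _.
  have h1 : C1 / v r <= C1 * C3 * p.
    rewrite -mulrA ler_pM2l// -[leLHS]mul1r ler_pdivrMr// mulrAC.
    by move: v2; rewrite -[p^-1]mul1r ler_pdivrMr// mulrAC.
  have h2 : 2 * r%:R / t <= 2 * C3 * p.
    by rewrite ler_pdivrMr//; lra.
  lra.
rewrite mulrC ler_pdivlMr//.
have k0 : 0 < k%:R :> R by rewrite ltr0n.
have kr0 : (0 < k * r)%N by rewrite muln_gt0.
have w0 : 0 < v (k * r)%N := lt_le_trans ltr01 (v_ge1 kr0).
set w := v (k * r)%N in w0.
(* The time scale of the radius kr; N is A rounded up, so A < N <= 2A and N/(2kr) <= w. *)
pose A := k%:R * r%:R * w.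
have A1 : 1 <= A.
  rewrite /A; apply: le_trans (v_ge1 kr0) _; rewrite ler_peMl ?(ltW w0)//.
  by rewrite -natrM ler1n.
pose N := (Num.truncn A).+1.
have /andP[N1 N2] : (Num.truncn A)%:R <= A < N%:R by apply: truncn_itv; exact: le_trans A1.
have N3 : N%:R <= 2 * A by rewrite /N -natr1; lra.
have N0 : 0 < N%:R :> R by rewrite ltr0n.
have := heat_kernel_mean_ge t0 r0 kr0 (ltn0Sn _ : (0 < N)%N) hm.
rewrite -/w => hl.
have h1 : (2 * (C2 + 1) * w)^-1 <= (2 * (C2 * w + N%:R / (2 * (k * r)%:R)))^-1.
  have q0 : 0 < 2 * (k * r)%:R :> R by rewrite mulr_gt0// ltr0n.
  have : N%:R / (2 * (k * r)%:R) <= w.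
    by rewrite ler_pdivrMr// natrM; apply: le_trans N3 _; rewrite /A; lra.
  have : 0 <= N%:R / (2 * (k * r)%:R) :> R by rewrite divr_ge0// ltW.
  move=> e0 e1; have e2 : 0 < C2 * w by rewrite mulr_gt0.
  by rewrite lef_pV2 ?posrE ?mulr_gt0//; lra.
have h2 : 2 * t / N%:R * (C1 / v r) <= 2 * C1 * C3 / (k%:R * w).
  have -> : 2 * t / N%:R * (C1 / v r) = 2 * C1 * t / (N%:R * v r).
    by field; rewrite !lt0r_neq0.
  apply: (@le_trans _ _ (2 * C1 * (C3 * (r%:R * v r)) / (A * v r))); last first.
    by rewrite le_eqVlt; apply/orP; left; apply/eqP; rewrite /A; field; rewrite !lt0r_neq0.
  apply: ler_pM.
  - by rewrite !mulr_ge0// ltW.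
  - by rewrite invr_ge0 mulr_ge0// ltW.
  - by rewrite ler_pM2l// mulr_gt0.
  - by rewrite lef_pV2 ?posrE ?mulr_gt0// ?ler_pM2r// ?(ltW N2)// (lt_le_trans ltr01).
have h3 : 4 * r%:R / N%:R <= 4 / (k%:R * w).
  apply: (@le_trans _ _ (4 * r%:R / A)); last first.
    by rewrite le_eqVlt; apply/orP; left; apply/eqP; rewrite /A; field; rewrite !lt0r_neq0.
  by rewrite ler_pM2l ?mulr_gt0// lef_pV2 ?posrE ?(ltW N2)// (lt_le_trans ltr01).
have h4 : (2 * C1 * C3 + 4) / (k%:R * w) <= (4 * (C2 + 1) * w)^-1.
  rewrite ler_pdivrMr ?mulr_gt0//.
  have -> : (4 * (C2 + 1) * w)^-1 * (k%:R * w) = k%:R / (4 * (C2 + 1)).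
    by field; rewrite !lt0r_neq0.
  by rewrite ler_pdivlMr ?mulr_gt0// mulrC.
have h5 : (2 * (C2 + 1) * w)^-1 = (4 * (C2 + 1) * w)^-1 + (4 * (C2 + 1) * w)^-1.
  by field; rewrite !lt0r_neq0.
have h6 : (2 * C1 * C3 + 4) / (k%:R * w) = 2 * C1 * C3 / (k%:R * w) + 4 / (k%:R * w).
  by rewrite mulrDl.
apply: (@le_trans _ _ (4 * (C2 + 1) * w)^-1); last by lra.
(* Doubling brings the scale kr back to r, where v is comparable to 1/phi. *)
have w1 : w <= Ck * (C3 / p) by apply: le_trans (vk r r0) _; rewrite ler_pM2l.
have -> : D^-1 * p = (4 * (C2 + 1) * (Ck * (C3 / p)))^-1.
  by rewrite /D; field; rewrite !lt0r_neq0.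
by rewrite lef_pV2 ?posrE ?mulr_gt0 ?divr_gt0 ?invr_gt0// ler_pM2l// mulr_gt0.
Qed.

End HeatKernelMoment.

(** * Scales *)

Section ScaleFunctions.
Variable R : realType.
Implicit Types (t x b : R).

Lemma nat_approx x : 1 <= x -> exists2 r : nat, (0 < r)%N & x <= r%:R <= 2 * x.
Proof.
move=> x1; exists (Num.truncn x).+1 => //.
have /andP[h1 h2] : (Num.truncn x)%:R <= x < (Num.truncn x).+1%:R.
  by apply: truncn_itv; exact: le_trans x1.
by rewrite (ltW h2)/= -natr1; lra.
Qed.

(** The exact solution of x * x^b = t is x = t^(1/(1+b)), for which x^b = 1/p and t p = x; r rounds
    x within a factor 2. *)
Lemma power_scale_phi b t : 1 <= b -> 1 <= t ->
  let p := powR t (- (b / (1 + b))) in let C := powR 2 b + 2 in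
  0 < t /\ 0 < p /\ exists2 r : nat, (0 < r)%N &
  [/\ powR r%:R b <= C / p, p^-1 <= C * powR r%:R b,
      r%:R <= C * (t * p) & t <= C * (r%:R * powR r%:R b)].
Proof.
move=> b1 t1 p C; have t0 : 0 < t := lt_le_trans ltr01 t1.
have p0 : 0 < p by rewrite powR_gt0.
have b0 : 0 <= b := le_trans ler01 b1.
have b10 : 0 < 1 + b by lra.
have B0 : 0 <= powR 2 b by exact: powR_ge0.
split=> //; split=> //; pose x := powR t (1 + b)^-1.
have x1 : 1 <= x by rewrite powR_ge1// invr_ge0 ltW.
have xE : t * p = x.
  rewrite -[X in X * _](@powRr1 R t) ?(ltW t0)// -powRD ?(gt_eqF t0) ?implybT//.
  by congr powR; field; rewrite lt0r_neq0.
have xb : powR x b = p^-1.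
  by rewrite /x -powRrM /p powRN invrK; congr powR; rewrite mulrC.
have [r r0 /andP[xr rx]] := nat_approx x1; exists r => //.
have r0' : 0 < r%:R :> R by rewrite ltr0n.
have x0 : 0 < x := lt_le_trans ltr01 x1.
have v1 : p^-1 <= powR r%:R b by rewrite -xb; apply: ge0_ler_powR; rewrite ?nnegrE// ltW.
have v2 : powR r%:R b <= powR 2 b * p^-1.
  by rewrite -xb -powRM ?(ltW x0)//; apply: ge0_ler_powR; rewrite ?nnegrE ?mulr_ge0 ?(ltW x0).
have pi0 : 0 < p^-1 by rewrite invr_gt0.
have v0 : 0 < powR r%:R b := lt_le_trans pi0 v1.
have C1 : 1 <= C by rewrite /C; lra.
split.
- by apply: le_trans v2 _; rewrite ler_pM2r// lerDl.
- by apply: le_trans v1 _; rewrite ler_peMl// ltW.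
- by rewrite xE; apply: le_trans rx _; rewrite ler_pM2r// lerDr.
- apply: (@le_trans _ _ (r%:R * powR r%:R b)); last by rewrite ler_peMl// mulr_ge0// ltW.
  have -> : t = x * p^-1 by rewrite -xE mulfK// lt0r_neq0.
  by apply: ler_pM => //; exact: ltW.
Qed.

Lemma ln_leB1 x : 0 < x -> ln x <= x - 1.
Proof.
move=> x0; have := @le_ln1Dx R (x - 1).
by rewrite (_ : 1 + (x - 1) = x); [apply; lra|ring].
Qed.

Lemma ln_le_half x : 0 < x -> ln x <= x / 2.
Proof.
move=> x0; have h := ln_leB1.
have -> : x = x / 2 * 2 by rewrite divfK.
rewrite lnM ?posrE ?divr_gt0//.
have := h (x / 2) (divr_gt0 x0 (ltr0n _ 2)); have := h 2 (ltr0n _ 2).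
by rewrite divfK//; lra.
Qed.

Lemma ln2_bounds : 1 / 2 <= ln (2 : R) <= 1.
Proof.
have h := ln_leB1.
apply/andP; split; last by have := h 2 (ltr0n _ 2); lra.
have := h 2^-1; rewrite lnV ?posrE// invr_gt0 ltr0n => /(_ isT); lra.
Qed.

Lemma trunc_log_ln r : (0 < r)%N ->
  ln (r%:R : R) <= (trunc_log 2 r).+1%:R /\ (trunc_log 2 r)%:R <= 2 * ln (r%:R : R).
Proof.
move=> r0; have r0' : 0 < r%:R :> R by rewrite ltr0n.
have /andP[l1 l2] := ln2_bounds; set L := trunc_log 2 r; split.
  apply: (@le_trans _ _ (ln (2 ^+ L.+1))).
    rewrite ler_ln ?posrE ?exprn_gt0// -natrX ler_nat ltnW//.
    exact: trunc_log_ltn.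
  by rewrite lnXn// -[leLHS]mulr_natr ler_piMl.
have : ln (2 ^+ L) <= ln (r%:R : R).
  by rewrite ler_ln ?posrE ?exprn_gt0// -natrX ler_nat trunc_logP.
rewrite lnXn// -[X in X <= _]mulr_natr => h.
have : 1 / 2 * L%:R <= ln 2 * L%:R :> R by rewrite ler_wpM2r.
lra.
Qed.

(** With l = ln t and x = t p = (t/l)^(1/2), one has x l = 1/p. Since ln x = (l - ln l)/2 lies
    between l/4 and l/2, the scale of r, which rounds x, is of order x l. *)
Lemma critical_scale_phi t : expR 1 <= t ->
  let p := powR t (- 2^-1) * powR (ln t) (- 2^-1) in
  0 < t /\ 0 < p /\ exists2 r : nat, (0 < r)%N &
  [/\ critical_scale R r <= 8 / p, p^-1 <= 8 * critical_scale R r,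
      r%:R <= 8 * (t * p) & t <= 8 * (r%:R * critical_scale R r)].
Proof.
move=> t1 p; have t0 : 0 < t := lt_le_trans (expR_gt0 1) t1.
pose l := ln t; have l1 : 1 <= l.
  by rewrite /l -(expRK 1) ler_ln ?posrE ?expR_gt0.
have l0 : 0 < l := lt_le_trans ltr01 l1.
have p0 : 0 < p by rewrite mulr_gt0// powR_gt0.
split=> //; split=> //; pose x := t * p.
have x0 : 0 < x by rewrite mulr_gt0.
have sq y : 0 < y -> powR y (- 2^-1) * powR y (- 2^-1) = y^-1.
  move=> y0; rewrite -powRD ?(gt_eqF y0) ?implybT//.
  rewrite -(powR_inv1 (ltW y0)); congr powR; lra.
have p2 : p * p = (t * l)^-1.
  by rewrite /p mulrACA !sq// invfM.
have xl : x * l = p^-1.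
  apply: (mulIf (lt0r_neq0 p0)); rewrite mulVf ?lt0r_neq0//.
  have -> : x * l * p = (t * l) * (p * p) by rewrite /x; ring.
  by rewrite p2 mulfV// mulf_neq0// lt0r_neq0.
have lnx : ln x = (l - ln l) / 2.
  rewrite /x lnM ?posrE// /p lnM ?posrE ?powR_gt0// !ln_powR -/l; lra.
have lnl0 : 0 <= ln l by exact: ln_ge0.
have lnl := ln_le_half l0.
have x1 : 1 <= x.
  have h : ln 1 < ln x by rewrite ln1 lnx; lra.
  by apply: ltW; rewrite -ltr_ln ?posrE.
have [r r0 /andP[xr rx]] := nat_approx x1; exists r => //.
have r0' : 0 < r%:R :> R by rewrite ltr0n.
have [L1 L2] := trunc_log_ln r0.
have /andP[_ l2] := ln2_bounds.
have lr1 : ln x <= ln (r%:R : R) by rewrite ler_ln ?posrE//.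
have lr2 : ln (r%:R : R) <= ln 2 + ln x.
  rewrite -lnM; [|by rewrite posrE..].
  by rewrite ler_ln; [exact: rx|rewrite posrE|rewrite posrE mulr_gt0].
rewrite /critical_scale natrM; set M := (trunc_log 2 r).+1%:R in L1 *.
have M1 : l / 4 <= M by lra.
have M2 : M <= 4 * l by rewrite /M -natr1; lra.
have M0 : 0 < M by rewrite /M ltr0n.
have rM : x * (l / 4) <= r%:R * M by apply: ler_pM => //; [exact: ltW|lra].
split.
- rewrite -xl; apply: (@le_trans _ _ (2 * x * (4 * l))); last lra.
  by apply: ler_pM => //; exact: ltW.
- have xl0 : 0 < x * l by rewrite mulr_gt0.
  rewrite -xl; lra.
- by rewrite -/x; lra.
- have -> : t = x * p^-1 by rewrite /x mulfK// lt0r_neq0.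
  rewrite -xl; apply: (@le_trans _ _ (r%:R * (4 * (r%:R * M)))).
    by apply: ler_pM => //; [exact: ltW|rewrite mulr_ge0// ltW|lra].
  have : 0 <= r%:R * (r%:R * M) by rewrite !mulr_ge0// ltW.
  lra.
Qed.

(** As k < 2^k, the logarithm grows by at most k, and k + L + 1 <= (k + 1)(L + 1). *)
Lemma critical_scale_doubling k r : (0 < k)%N -> (0 < r)%N ->
  critical_scale R (k * r) <= (k * k.+1)%N%:R * critical_scale R r.
Proof.
move=> k0 r0; rewrite /critical_scale -natrM ler_nat.
have kr0 : (0 < k * r)%N by rewrite muln_gt0 k0.
set L := trunc_log 2 r.
have LL : (trunc_log 2 (k * r) < k + L.+1)%N.
  rewrite -(ltn_exp2l (m := 2))//; apply: leq_ltn_trans (trunc_logP _ kr0) _ => //.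
  by rewrite expnD; apply: ltn_mul; [exact: ltn_expl|exact: trunc_log_ltn].
rewrite mulnACA leq_mul2l (leq_trans LL) ?orbT//.
by rewrite mulSn addnC leq_add2l leq_pmulr.
Qed.

End ScaleFunctions.

(** * The three regimes and the conclusion *)

Lemma two_sided_bound_moment1 (R : realType) (alpha : R) (d : measure_display)
    (Omega : measurableType d) (P : probability Omega R) (tau : int -> Omega -> R) :
  0 < alpha -> pareto_iid_env P alpha tau -> two_sided_bound P alpha tau 1.
Proof.
move=> a0 henv.
have doubling b (k : nat) : (0 < k)%N -> exists2 C : R, 0 < C & forall r, (0 < r)%N ->
    powR (k * r)%:R b <= C * powR r%:R b.
  move=> k0; exists (powR k%:R b); first by rewrite powR_gt0// ltr0n.
  by move=> r _; rewrite natrM powRM.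
have ge1 b r : 1 <= b -> (0 < r)%N -> 1 <= powR r%:R b :> R.
  by move=> b1 r0; rewrite powR_ge1 ?ler1n// (le_trans _ b1).
have [a1|a1|a1] := ltrgtP alpha 1.
- have [C1 C10 hC1] := inv_half_volume_mean_le_sub a0 henv.
  have [C2 C20 hC2] := inv_volume_mean_ge_sub a0 henv a1.
  have b1 : 1 <= alpha^-1 by rewrite invf_ge1// ltW.
  apply: (@two_sided_of_scale _ _ _ _ _ _ henv (fun r => powR r%:R alpha^-1)
    C1 C2 (powR 2 alpha^-1 + 2) 1) => //.
  + by move=> r r0; apply: ge1.
  + by move=> k k0; apply: doubling.
  + move=> t t1; rewrite /phi_alpha a1.
    (* Matches the exponent of phi with the scale exponent b = 1/alpha. *)
    have -> : (1 + alpha)^-1 = alpha^-1 / (1 + alpha^-1).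
      by field; rewrite ?lt0r_neq0//; lra.
    exact: power_scale_phi.
- have [C2 C20 hC2] := inv_volume_mean_ge_super a0 henv a1.
  have E r : powR r%:R 1 = r%:R :> R by rewrite powRr1.
  (* The linear scale is written as the power b = 1 to reuse [power_scale_phi]. *)
  apply: (@two_sided_of_scale _ _ _ _ _ _ henv (fun r => powR r%:R 1) 1 C2 (powR 2 1 + 2) 1) => //.
  + by move=> r r0; apply: ge1.
  + move=> r m r0 hm; rewrite E mul1r.
    exact: (inv_half_volume_mean_le_super henv r0 hm).
  + by move=> r c m r0 c0 hm; rewrite E; exact: hC2.
  + by move=> k k0; apply: doubling.
  + move=> t t1; rewrite /phi_alpha (ltNge alpha) (ltW a1)/= gt_eqF//.
    have -> : (2^-1 : R) = 1 / (1 + 1) by rewrite mul1r.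
    exact: power_scale_phi.
- apply: (@two_sided_of_scale _ _ _ _ _ _ henv (critical_scale R) 36 40 8 (expR 1)) => //.
  + by move=> r r0; rewrite /critical_scale ler1n muln_gt0 r0.
  + by move=> r m; apply: (inv_half_volume_mean_le_critical henv a1).
  + by move=> r c m; apply: (inv_volume_mean_ge_critical henv a1).
  + move=> k k0; exists (k * k.+1)%N%:R; first by rewrite ltr0n muln_gt0 k0.
    by move=> r r0; apply: critical_scale_doubling.
  + move=> t t1; rewrite /phi_alpha a1 ltxx eqxx.
    exact: critical_scale_phi.
Qed.

Theorem mainTheorem5 (R : realType) (alpha : R) (halpha : 0 < alpha) :
  (exists eps : R, 0 < eps /\
     forall (d : measure_display) (Omega : measurableType d)
            (P : probability Omega R) (tau : int -> Omega -> R),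
       pareto_iid_env P alpha tau -> two_sided_bound P alpha tau eps) /\
  (3 / 2 < alpha ->
     forall (d : measure_display) (Omega : measurableType d)
            (P : probability Omega R) (tau : int -> Omega -> R),
       pareto_iid_env P alpha tau -> two_sided_bound P alpha tau 1).
Proof.
split=> [|_]; last by move=> d Omega P tau; exact: two_sided_bound_moment1.
by exists 1; split=> // d Omega P tau; exact: two_sided_bound_moment1.
Qed.
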